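(* Suppose $S$ is a stationary subset of a regular uncountable cardinal $\kappa$. If $\mathrm{Dl}^*_S(\Pi^1_2)$ holds, then, for every analytic quasi-order $Q$ over $\kappa^\kappa$, ${Q}\hookrightarrow_1{\subseteq^S}$.
   Context: **Generalized descriptive set theory.** A quasi-order is a reflexive and transitive binary relation. The space $\kappa^\kappa$ carries the bounded topology, whose basic open sets are $[\zeta]=\{\eta\in\kappa^\kappa\mid \zeta\subset\eta\}$ for $\zeta\in\kappa^{<\kappa}$; finite products carry the product topology. A quasi-order $Q$ over $\kappa^\kappa$ is analytic iff there is a closed $F\subseteq(\kappa^\kappa\times\kappa^\kappa)\times\kappa^\kappa$ with $Q=\{(\eta,\xi)\mid \exists\zeta\in\kappa^\kappa\ (\eta,\xi,\zeta)\in F\}$. For a stationary $S\subseteq\kappa$, $\le^S$ is the quasi-order on $\kappa^\kappa$ given by: $\eta\le^S\xi$ iff $\{\alpha\in S\mid \eta(\alpha)>\xi(\alpha)\}$ is nonstationary. The restriction of $\le^S$ to $2^\kappa$ is denoted $\subseteq^S$. Let $\Delta(\eta,\xi):=\min(\{\alpha<\kappa\mid\eta(\alpha)\ne\xi(\alpha)\}\cup\{\kappa\})$. For binary relations $R_1,R_2$ over $X_1,X_2\in\{2^\kappa,\kappa^\kappa\}$ respectively, $R_1\hookrightarrow_1R_2$ means that there is $f:X_1\to X_2$ such that for all $\eta,\xi\in X_1$: (a) $\eta\mathrel{R_1}\xi$ iff $f(\eta)\mathrel{R_2}f(\xi)$; and (b) $\Delta(\eta,\xi)\le\Delta(f(\eta),f(\xi))$.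 **Logic.** A $\Pi^1_2$-sentence $\phi$ is a formula of the form $\forall X\exists Y\varphi$, where $\varphi$ is a first-order sentence over a relational language $\mathcal L$ having: a binary predicate symbol $\epsilon$; a predicate symbol $\mathbb X$ of (finite) arity $m(\mathbb X)$; a predicate symbol $\mathbb Y$ of arity $m(\mathbb Y)$; and infinitely many predicate symbols $(\mathbb A_n)_{n\in\omega}$, each $\mathbb A_n$ of arity $m(\mathbb A_n)$. A set $N$ sees a set $x$ iff $N$ is transitive, p.r.-closed (closed under primitive recursive set functions), and $x\cup\{x\}\subseteq N$. Suppose $N$ sees an ordinal $\alpha$, $\phi=\forall X\exists Y\varphi$ is a $\Pi^1_2$-sentence and $A_n\subseteq\alpha^{m(\mathbb A_n)}$ for all $n\in\omega$. Then $\langle\alpha,\in,(A_n)_{n\in\omega}\rangle\models_N\phi$ means that: (1) $(A_n)_{n\in\omega}\in N$; and (2) $\langle N,\in\rangle\models(\forall X\subseteq\alpha^{m(\mathbb X)})(\exists Y\subseteq\alpha^{m(\mathbb Y)})[\langle\alpha,\in,X,Y,(A_n)_{n\in\omega}\rangle\models\varphi]$, where $\in,X,Y,A_n$ interpret $\epsilon,\mathbb X,\mathbb Y,\mathbb A_n$, respectively. For an ordinal $\alpha$, $\alpha^+$ denotes $|\alpha|^+$, and $\langle\alpha,\in,(A_n)_{n\in\omega}\rangle\models\phi$ abbreviates $\langle\alpha,\in,(A_n)_{n\in\omega}\rangle\models_{H_{\alpha^+}}\phi$. **The principle.** For $\kappa$ regular uncountable and $S\subseteq\kappa$ stationary, $\mathrm{Dl}^*_S(\Pi^1_2)$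 asserts the existence of a sequence $\langle N_\alpha\mid\alpha\in S\rangle$ such that: (1) for every $\alpha\in S$, $N_\alpha$ is a set of cardinality $<\kappa$ that sees $\alpha$; (2) for every $X\subseteq\kappa$, there is a club $C\subseteq\kappa$ such that $X\cap\alpha\in N_\alpha$ for all $\alpha\in C\cap S$; (3) whenever $\langle\kappa,\in,(A_n)_{n\in\omega}\rangle\models\phi$, with $\phi$ a $\Pi^1_2$-sentence, there are stationarily many $\alpha\in S$ such that $|N_\alpha|=|\alpha|$ and $\langle\alpha,\in,(A_n\cap(\alpha^{m(\mathbb A_n)}))_{n\in\omega}\rangle\models_{N_\alpha}\phi$. *)

(* Defs.v *)
From mathcomp Require Import all_boot.
From mathcomp Require Import boolp.

Set Implicit Arguments.
Unset Strict Implicit.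
Unset Printing Implicit Defensive.

(* Well-founded trees, compared by bisimulation. [V] below is the quotient by
   bisimulation (as a subtype of canonical representatives), so that equality of
   sets is Leibniz equality; it is a model of ZFC whose natural numbers are
   those of Rocq. *)
Inductive tree : Type := Tree (A : Type) (f : A -> tree).

Fixpoint bisim (x y : tree) : Prop :=
  match x, y with
  | Tree A f, Tree B g =>
      (forall a, exists b, bisim (f a) (g b)) /\
      (forall b, exists a, bisim (f a) (g b))
  end.

Lemma bisim_refl x : bisim x x.
Proof. by elim: x => A f IH; split=> a; exists a. Qed.

Lemma bisim_sym x y : bisim x y -> bisim y x.
Proof.
elim: x y => A f IH [B g] /= [fg gf].
by split=> [b|a]; [have [a /IH] := gf b; exists a | have [b /IH] := fg a; exists b].
Qed.

Lemma bisim_trans x y z : bisim x y -> bisim y z -> bisim x z.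
Proof.
elim: x y z => A f IH [B g] [C h] /= [fg gf] [gh hg]; split=> [a|c].
  by have [b ab] := fg a; have [c bc] := gh b; exists c; apply: IH ab bc.
by have [b bc] := hg c; have [a ab] := gf b; exists a; apply: IH ab bc.
Qed.

Definition canon (x : tree) : tree :=
  projT1 (cid (ex_intro (bisim ^~ x) x (bisim_refl x))).

Lemma canonP x : bisim (canon x) x.
Proof. by rewrite /canon; case: cid. Qed.

Lemma canon_eq x y : bisim x y -> canon x = canon y.
Proof.
move=> xy; rewrite /canon.
have E : bisim ^~ x = bisim ^~ y.
  by apply/funext => z; apply/propext; split=> zx; apply: bisim_trans zx _ => //;
     apply: bisim_sym.
move: (ex_intro (bisim ^~ x) _ _) (ex_intro (bisim ^~ y) _ _); rewrite E => p q.
by rewrite (Prop_irrelevance p q).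
Qed.

Lemma canon_idem x : canon (canon x) = canon x.
Proof. exact: canon_eq (canonP x). Qed.

Definition V : Type := {x : tree | canon x = x}.

Definition V_of_tree (x : tree) : V := exist _ (canon x) (canon_idem x).

Definition idx (x : V) : Type := let: Tree A _ := sval x in A.

Definition elt (x : V) : idx x -> V :=
  match sval x as t return (let: Tree A _ := t in A) -> V with
  | Tree _ f => fun a => V_of_tree (f a)
  end.

Definition memV (x y : V) : Prop := exists a : idx y, x = elt a.
Notation "x ∈ y" := (memV x y) (at level 70, no associativity).

Definition subsetV (x y : V) : Prop := forall z, z ∈ x -> z ∈ y.
Notation "x ⊆ y" := (subsetV x y) (at level 70, no associativity).

Definition mkV (A : Type) (f : A -> V) : V :=
  V_of_tree (Tree (fun a => sval (f a))).

Lemma V_inj (x y : V) : sval x = sval y -> x = y.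
Proof.
by case: x y => [x px] [y py] /= xy; case: _ / xy py => py; rewrite (Prop_irrelevance px py).
Qed.

Lemma V_of_treeK (x : V) : V_of_tree (sval x) = x.
Proof. by apply: V_inj; rewrite /= (svalP x). Qed.

Lemma V_of_tree_eq x y : bisim x y -> V_of_tree x = V_of_tree y.
Proof. by move=> xy; apply: V_inj; apply: canon_eq. Qed.

Lemma mem_tree x A (f : A -> tree) :
  x ∈ V_of_tree (Tree f) <-> exists a, x = V_of_tree (f a).
Proof.
rewrite /memV /elt /idx /=; move: (canonP (Tree f)).
case: (canon _) => B g /= [gf fg]; split=> -[].
  by move=> b ->; have [a /V_of_tree_eq ->] := gf b; exists a.
by move=> a ->; have [b /V_of_tree_eq <-] := fg a; exists b.
Qed.

Lemma mem_mkV A (f : A -> V) x : x ∈ mkV f <-> exists a, x = f a.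
Proof.
apply: (iff_trans (mem_tree _ _)).
by split=> -[a ->]; exists a; rewrite V_of_treeK.
Qed.

Lemma mem_elt x (a : idx x) : elt a ∈ x.
Proof. by exists a. Qed.

Lemma V_ext x y : (forall z, z ∈ x <-> z ∈ y) -> x = y.
Proof.
rewrite -(V_of_treeK x) -(V_of_treeK y).
case: (sval x) (sval y) => A f [B g] E; apply: V_of_tree_eq.
have bs s t : V_of_tree s = V_of_tree t -> bisim s t.
  move=> /(congr1 sval) /= st.
  by apply: bisim_trans (canonP t); rewrite -st; apply/bisim_sym/canonP.
split=> [a|b].
  have /E : V_of_tree (f a) ∈ V_of_tree (Tree f) by apply/mem_tree; exists a.
  by move=> /mem_tree [b /bs]; exists b.
have /E : V_of_tree (g b) ∈ V_of_tree (Tree g) by apply/mem_tree; exists b.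
by move=> /mem_tree [a /bs /bisim_sym]; exists a.
Qed.

Lemma V_ind (P : V -> Prop) :
  (forall x, (forall y, y ∈ x -> P y) -> P x) -> forall x, P x.
Proof.
move=> IH x; rewrite -(V_of_treeK x); elim: (sval x) => A f IHf.
by apply: IH => y /mem_tree [a ->].
Qed.

Definition emptyset : V := mkV (fun e : void => match e with end).
Notation "∅" := emptyset.

Definition upair (x y : V) : V := mkV (fun b : bool => if b then x else y).

Definition bigunion (x : V) : V :=
  mkV (fun p : {a : idx x & idx (elt a)} => elt (tagged p)).

Definition sep (x : V) (P : V -> Prop) : V :=
  mkV (fun p : {a : idx x | P (elt a)} => elt (sval p)).

Definition repl (x : V) (F : V -> V) : V := mkV (fun a : idx x => F (elt a)).

Definition union (x y : V) : V := bigunion (upair x y).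
Definition inter (x y : V) : V := sep x (fun z => z ∈ y).
Definition adjoin (x y : V) : V := union x (upair y y).

Definition opair (x y : V) : V := upair (upair x x) (upair x y).

Lemma mem_empty x : ~ x ∈ ∅.
Proof. by move=> /mem_mkV [[]]. Qed.

Lemma mem_upair x y z : z ∈ upair x y <-> z = x \/ z = y.
Proof.
split=> [/mem_mkV [[] ->]|]; [by left | by right |].
by case=> ->; apply/mem_mkV; [exists true | exists false].
Qed.

Lemma mem_bigunion x z : z ∈ bigunion x <-> exists2 y, y ∈ x & z ∈ y.
Proof.
split=> [/mem_mkV [[a b] ->]|[y [a ->] [b ->]]].
  by exists (elt a); apply: mem_elt.
by apply/mem_mkV; exists (Tagged (fun a => idx (elt a)) b).
Qed.

Lemma mem_sep x P z : z ∈ sep x P <-> z ∈ x /\ P z.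
Proof.
split=> [/mem_mkV [[a Pa] ->]|[[a ->] Pa]]; first by split=> //; apply: mem_elt.
by apply/mem_mkV; exists (exist _ a Pa).
Qed.

Lemma mem_repl x F z : z ∈ repl x F <-> exists2 y, y ∈ x & z = F y.
Proof.
split=> [/mem_mkV [a ->]|[y [a ->] ->]]; first by exists (elt a) => //; exists a.
by apply/mem_mkV; exists a.
Qed.

Lemma mem_union x y z : z ∈ union x y <-> z ∈ x \/ z ∈ y.
Proof.
split=> [/mem_bigunion [w /mem_upair [->|->]]|]; [by left | by right |].
by case=> zx; apply/mem_bigunion; [exists x | exists y]=> //; apply/mem_upair; auto.
Qed.

Lemma mem_adjoin x y z : z ∈ adjoin x y <-> z ∈ x \/ z = y.
Proof.
apply: (iff_trans (mem_union _ _ _)).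
by split=> -[zx|H]; [left | right | left | right]=> //;
   [case/mem_upair: H | apply/mem_upair; left].
Qed.

(* Definite description; the junk value [∅] is only used when nothing
   satisfies [P]. *)
Definition the (P : V -> Prop) : V :=
  if pselect (exists x, P x) is left h then projT1 (cid h) else ∅.

Definition is_fun (f a b : V) : Prop :=
  (forall p, p ∈ f -> exists x y, [/\ x ∈ a, y ∈ b & p = opair x y]) /\
  (forall x, x ∈ a -> exists! y, opair x y ∈ f).

Definition app (f x : V) : V := the (fun y => opair x y ∈ f).

Definition transitive_set (x : V) : Prop := forall y, y ∈ x -> y ⊆ x.

Definition ordinal (x : V) : Prop :=
  transitive_set x /\ forall y, y ∈ x -> transitive_set y.

Fixpoint nat_V (n : nat) : V :=
  if n is m.+1 then adjoin (nat_V m) (nat_V m) else ∅.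

Definition omega : V := mkV nat_V.

(* On ordinals [⊆] is the order [<=] and [∈] is [<]. *)
Definition ord_min (A : V) : V :=
  the (fun m => m ∈ A /\ forall a, a ∈ A -> m ⊆ a).

Definition inj_on (x : V) (f : V -> V) : Prop :=
  forall u v, u ∈ x -> v ∈ x -> f u = f v -> u = v.

Definition card_le (x y : V) : Prop :=
  exists f : V -> V, (forall u, u ∈ x -> f u ∈ y) /\ inj_on x f.

Definition card_eq (x y : V) : Prop :=
  exists f : V -> V, [/\ forall u, u ∈ x -> f u ∈ y, inj_on x f &
                         forall v, v ∈ y -> exists2 u, u ∈ x & f u = v].

Definition card_lt (x y : V) : Prop := card_le x y /\ ~ card_eq x y.

Definition cardinal (k : V) : Prop :=
  ordinal k /\ forall b, b ∈ k -> ~ card_eq b k.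

Definition regular_uncountable (k : V) : Prop :=
  [/\ cardinal k, omega ∈ k &
      forall (b : V) (f : V -> V), b ∈ k -> (forall x, x ∈ b -> f x ∈ k) ->
        exists2 c, c ∈ k & forall x, x ∈ b -> f x ∈ c].

Definition succ_cardinal (a m : V) : Prop :=
  [/\ cardinal m, card_lt a m &
      forall n, cardinal n -> card_lt a n -> m ⊆ n].

Definition transitive_closure (x t : V) : Prop :=
  [/\ transitive_set t, x ⊆ t &
      forall t', transitive_set t' -> x ⊆ t' -> t ⊆ t'].

(* The class [H_m] of sets hereditarily of cardinality [< m]. *)
Definition Hset (m : V) (x : V) : Prop :=
  exists2 t, transitive_closure x t & card_lt t m.

Definition club (k C : V) : Prop :=
  [/\ C ⊆ k,
      forall b, b ∈ k -> exists2 c, c ∈ C & b ∈ c &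
      forall d, d ∈ k -> d <> ∅ ->
        (forall b, b ∈ d -> exists c, [/\ c ∈ C, c ∈ d & b ∈ c]) -> d ∈ C].

Definition stationary (k T : V) : Prop :=
  T ⊆ k /\ forall C, club k C -> exists2 a, a ∈ C & a ∈ T.

Definition baire (k : V) (eta : V) : Prop := is_fun eta k k.
Definition cantor (k : V) (eta : V) : Prop := is_fun eta k (nat_V 2).

Definition bounded_fun (k : V) (z : V) : Prop :=
  exists2 b, b ∈ k & is_fun z b k.

Definition cone (k z : V) (eta : V) : Prop := baire k eta /\ z ⊆ eta.

(* Open sets of the product [(k^k * k^k) * k^k], with base the boxes of cones. *)
Definition open3 (k : V) (U : V -> V -> V -> Prop) : Prop :=
  (forall eta xi zeta, U eta xi zeta ->
     [/\ baire k eta, baire k xi & baire k zeta]) /\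
  forall eta xi zeta, U eta xi zeta ->
    exists a b c,
      [/\ [/\ bounded_fun k a, bounded_fun k b & bounded_fun k c],
          [/\ cone k a eta, cone k b xi & cone k c zeta] &
          forall eta' xi' zeta', cone k a eta' -> cone k b xi' ->
            cone k c zeta' -> U eta' xi' zeta'].

Definition closed3 (k : V) (F : V -> V -> V -> Prop) : Prop :=
  (forall eta xi zeta, F eta xi zeta ->
     [/\ baire k eta, baire k xi & baire k zeta]) /\
  open3 k (fun eta xi zeta =>
    [/\ baire k eta, baire k xi, baire k zeta & ~ F eta xi zeta]).

Definition quasi_order (X : V -> Prop) (Q : V -> V -> Prop) : Prop :=
  [/\ forall x y, Q x y -> X x /\ X y,
      forall x, X x -> Q x x &
      forall x y z, Q x y -> Q y z -> Q x z].

Definition analytic (k : V) (Q : V -> V -> Prop) : Prop :=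
  exists2 F, closed3 k F &
    forall eta xi, Q eta xi <->
      [/\ baire k eta, baire k xi &
          exists2 zeta, baire k zeta & F eta xi zeta].

Definition le_mod (k S : V) (eta xi : V) : Prop :=
  [/\ baire k eta, baire k xi &
      ~ stationary k (sep S (fun a => app xi a ∈ app eta a))].

Definition sub_mod (k S : V) (eta xi : V) : Prop :=
  [/\ cantor k eta, cantor k xi & le_mod k S eta xi].

Definition Delta (k eta xi : V) : V :=
  ord_min (adjoin (sep k (fun a => app eta a <> app xi a)) k).

Definition reduces1 (k : V) (X1 : V -> Prop) (R1 : V -> V -> Prop)
    (X2 : V -> Prop) (R2 : V -> V -> Prop) : Prop :=
  exists2 f : V -> V, forall eta, X1 eta -> X2 (f eta) &
    forall eta xi, X1 eta -> X1 xi ->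
      (R1 eta xi <-> R2 (f eta) (f xi)) /\
      Delta k eta xi ⊆ Delta k (f eta) (f xi).

(* The primitive recursive set functions of Jensen and Karp. *)
Inductive prim_rec : forall n, (n.-tuple V -> V) -> Prop :=
| PR_proj n (i : 'I_n) : prim_rec (fun x : n.-tuple V => tnth x i)
| PR_zero n : prim_rec (fun _ : n.-tuple V => ∅)
| PR_adjoin :
    prim_rec (fun x : 2.-tuple V => adjoin (nth ∅ x 0) (nth ∅ x 1))
| PR_cond :
    prim_rec (fun x : 4.-tuple V =>
      if `[< nth ∅ x 2 ∈ nth ∅ x 3 >] then nth ∅ x 0 else nth ∅ x 1)
| PR_comp n p (G : p.-tuple V -> V) (H : 'I_p -> n.-tuple V -> V) :
    prim_rec G -> (forall i, prim_rec (H i)) ->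
    prim_rec (fun x => G [tuple H i x | i < p])
| PR_rec n (G : n.+2.-tuple V -> V) (F : n.+1.-tuple V -> V) :
    prim_rec G ->
    (forall (z : V) (x : n.-tuple V),
       F [tuple of z :: x] =
       G [tuple of bigunion (repl z (fun u => F [tuple of u :: x])) :: z :: x]) ->
    prim_rec F.

Definition pr_closed (N : V) : Prop :=
  forall n (F : n.-tuple V -> V), prim_rec F ->
    forall x : n.-tuple V, (forall i, tnth x i ∈ N) -> F x ∈ N.

Definition sees (N x : V) : Prop :=
  [/\ transitive_set N, pr_closed N & adjoin x x ⊆ N].

Record language := Language {
  arX : nat;
  arY : nat;
  arA : nat -> nat }.

(* Variables are named by natural numbers. *)
Inductive formula (L : language) : Type :=
| Eps (i j : nat)
| Eq (i j : nat)
| PredX (v : (arX L).-tuple nat)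
| PredY (v : (arY L).-tuple nat)
| PredA (n : nat) (v : (arA L n).-tuple nat)
| Not (f : formula L)
| And (f g : formula L)
| Or (f g : formula L)
| Imp (f g : formula L)
| All (i : nat) (f : formula L)
| Ex (i : nat) (f : formula L).

Fixpoint free_vars L (f : formula L) : seq nat :=
  match f with
  | Eps i j | Eq i j => [:: i; j]
  | PredX v => v
  | PredY v => v
  | PredA _ v => v
  | Not f => free_vars f
  | And f g | Or f g | Imp f g => free_vars f ++ free_vars g
  | All i f | Ex i f => [seq j <- free_vars f | j != i]
  end.

(* The sentence [forall X, exists Y, matrix]. *)
Record pi12 := Pi12 {
  lang :> language;
  matrix : formula lang;
  matrix_closed : free_vars matrix = [::] }.

Definition is_tuple (m : nat) (a t : V) : Prop := is_fun t (nat_V m) a.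

Definition tuple_V (s : seq V) : V :=
  mkV (fun i : {i : nat | i < size s} =>
    opair (nat_V (sval i)) (nth ∅ s (sval i))).

Definition seq_V (A : nat -> V) : V :=
  mkV (fun n : nat => opair (nat_V n) (A n)).

Definition update (e : nat -> V) (i : nat) (x : V) (j : nat) : V :=
  if j == i then x else e j.

Fixpoint sat L (a X Y : V) (A : nat -> V) (e : nat -> V) (f : formula L) : Prop :=
  match f with
  | Eps i j => e i ∈ e j
  | Eq i j => e i = e j
  | PredX v => tuple_V [seq e i | i <- v] ∈ X
  | PredY v => tuple_V [seq e i | i <- v] ∈ Y
  | PredA n v => tuple_V [seq e i | i <- v] ∈ A n
  | Not f => ~ sat a X Y A e f
  | And f g => sat a X Y A e f /\ sat a X Y A e g
  | Or f g => sat a X Y A e f \/ sat a X Y A e g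
  | Imp f g => sat a X Y A e f -> sat a X Y A e g
  | All i f => forall x, x ∈ a -> sat a X Y A (update e i x) f
  | Ex i f => exists2 x, x ∈ a & sat a X Y A (update e i x) f
  end.

Definition rel_on (m : nat) (a X : V) : Prop :=
  forall t, t ∈ X -> is_tuple m a t.

(* [N] is a class so that [models_in] also applies to [H_m]. The first-order
   statement [<a, ∈, X, Y, A> |= matrix] only involves quantifiers bounded by
   [a], hence means the same in a transitive p.r.-closed [N] as in [V]. The
   initial assignment is irrelevant because [matrix] is closed. *)
Definition models_in (N : V -> Prop) (a : V) (A : nat -> V) (phi : pi12) : Prop :=
  N (seq_V A) /\
  forall X, N X -> rel_on (arX phi) a X ->
    exists Y, [/\ N Y, rel_on (arY phi) a Y &
                  sat a X Y A (fun _ => ∅) (matrix phi)].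

(* [m] is the successor cardinal of [|a|], which exists and is unique. *)
Definition models (a : V) (A : nat -> V) (phi : pi12) : Prop :=
  forall m, succ_cardinal a m -> models_in (Hset m) a A phi.

(* The principle [Dl^*_S(Pi^1_2)]; only the values of [N] on [S] matter. *)
Definition Dl_star (k S : V) : Prop :=
  exists N : V -> V,
    [/\ forall a, a ∈ S -> card_lt (N a) k /\ sees (N a) a,
        forall X, X ⊆ k -> exists2 C, club k C &
          forall a, a ∈ C -> a ∈ S -> inter X a ∈ N a &
        forall (phi : pi12) (A : nat -> V),
          (forall n, rel_on (arA phi n) k (A n)) ->
          models k A phi ->
          stationary k (sep S (fun a =>
            card_eq (N a) a /\
            models_in (fun x => x ∈ N a) a
              (fun n => sep (A n) (is_tuple (arA phi n) a)) phi))].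

(* Main.v *)
(* Fix an injection of [k * k] into [k] and code [eta : k -> k] by the set
   [coded k eta] of codes of its pairs [(x, eta x)]. Every bounded subset of [k]
   lies in some [N a], so [k] of them suffice, and the closed set [F] projecting
   onto [Q] becomes definable over [<k, ∈>] from the list of the basic boxes it
   misses; clubs of [a] reflect "[F eta xi zeta]" to the restrictions of the codes
   to [a]. Let [mark b eta a = 1] when [a ∈ S] has [|N a| = |a|], the reflected
   relation [Q_a] is transitive in [N a], and the [b]-th guess read off an
   enumeration of [N a] of length [a] is equal to, or [Q_a]-below, the code of
   [eta] restricted to [a]. Transitivity makes [eta Q xi] imply
   [mark b eta <= mark b xi] on a club, and [mark b eta a] only depends on [eta]
   below [a]. If no [b] gave a reduction, take for each [b] a pair with
   [~ eta_b Q xi_b] and [mark b eta_b <= mark b xi_b] on a club. The statement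
   "[Q] is transitive and [~ eta_b Q xi_b] for all [b]" is Pi^1_2, hence reflects
   to some [a] in the diagonal intersection of these clubs. There the whole
   family [(eta_b)] restricted to [a] belongs to [N a], so it is its [b]-th
   element for some [b ∈ a]; then the [b]-th guess is the code of [eta_b], and
   [a] separates the marks of [eta_b] and [xi_b], a contradiction. *)
From mathcomp Require Import all_boot.
From mathcomp Require Import boolp.
Require Import Defs.

Set Implicit Arguments.
Unset Strict Implicit.
Unset Printing Implicit Defensive.

(** * Ordinals, functions and 2-tuples *)

Lemma memV_wf : well_founded memV.
Proof. by move=> x; elim/V_ind: x => x IH; constructor. Qed.

Lemma memV_irrefl x : ~ x ∈ x.
Proof. by elim/V_ind: x => x IH xx; apply: (IH x). Qed.

Lemma V_choice (P : V -> Prop) (R : V -> V -> Prop) :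
  (forall x, P x -> exists y, R x y) ->
  exists f, forall x, P x -> R x (f x).
Proof.
move=> H; have [|f Hf] := @choice V V (fun x y => P x -> R x y); last by exists f.
move=> x; have [Px|nPx] := pselect (P x); first by have [y] := H x Px; exists y.
by exists ∅.
Qed.

Lemma upair_inj x y z : upair x y = upair x z -> y = z.
Proof.
move=> E; have : y ∈ upair x z by rewrite -E mem_upair; right.
rewrite mem_upair => -[yx|//].
have : z ∈ upair x y by rewrite E mem_upair; right.
by rewrite mem_upair => -[->|->].
Qed.

Lemma opair_inj x y z w : opair x y = opair z w -> x = z /\ y = w.
Proof.
move=> E; have xz : x = z.
  have : upair x x ∈ opair z w by rewrite -E mem_upair; left.
  have xx : x ∈ upair x x by rewrite mem_upair; left.
  rewrite mem_upair => -[] F.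
    by move: xx; rewrite F mem_upair => -[].
  have zx : z ∈ upair x x by rewrite F mem_upair; left.
  by move: zx; rewrite mem_upair => -[].
by split=> //; move: E; rewrite xz => /upair_inj/upair_inj.
Qed.

Lemma mem_inter x y z : z ∈ inter x y <-> z ∈ x /\ z ∈ y.
Proof. exact: mem_sep. Qed.

Definition succV (x : V) : V := adjoin x x.

Lemma mem_succV x y : y ∈ succV x <-> y ∈ x \/ y = x.
Proof. exact: mem_adjoin. Qed.

Lemma mem_succV_self x : x ∈ succV x.
Proof. by apply/mem_succV; right. Qed.

Lemma ordinal_mem x y : ordinal x -> y ∈ x -> ordinal y.
Proof.
move=> [tx tex] yx; split; first exact: tex.
by move=> z zy; apply: tex; apply: tx zy.
Qed.

Lemma ordinal_trans x y z : ordinal x -> z ∈ y -> y ∈ x -> z ∈ x.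
Proof. by move=> [tx _] zy yx; apply: tx zy. Qed.

(** Double induction: if [x] neither equals nor belongs to an element of [y], and conversely, the
    induction hypotheses yield both inclusions. *)
Lemma ordinal_trichotomy x y : ordinal x -> ordinal y -> [\/ x ∈ y, x = y | y ∈ x].
Proof.
elim/V_ind: x y => x IHx; elim/V_ind => y IHy ox oy.
have [[y' y'y E]|ny] := pselect (exists2 y', y' ∈ y & (x ∈ y' \/ x = y')).
  by constructor 1; case: E => [xy'|-> //]; apply: ordinal_trans xy' y'y.
have [[x' x'x E]|nx] := pselect (exists2 x', x' ∈ x & (y ∈ x' \/ y = x')).
  by constructor 3; case: E => [xy'|-> //]; apply: ordinal_trans xy' x'x.
constructor 2; apply: V_ext => z; split=> zx.
  have [//||] := IHx z zx y (ordinal_mem ox zx) oy.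
    by move=> zy; case: nx; exists z; auto.
  by move=> zy; case: nx; exists z; auto.
have [|| //] := IHy z zx ox (ordinal_mem oy zx).
  by move=> zy; case: ny; exists z; auto.
by move=> zy; case: ny; exists z; auto.
Qed.

Lemma ordinal_sub x y : ordinal x -> ordinal y -> x ⊆ y -> x ∈ y \/ x = y.
Proof.
move=> ox oy xy; have [|//|/xy/memV_irrefl//] := ordinal_trichotomy ox oy; by auto.
Qed.

Lemma ordinal_memPn x y : ordinal x -> ordinal y -> ~ x ∈ y -> y ⊆ x.
Proof.
move=> ox oy nxy; have [//|->//|yx] := ordinal_trichotomy ox oy.
by move=> z zy; apply: ordinal_trans zy yx.
Qed.

Lemma ordinal_sub_mem k x y : ordinal k -> ordinal x -> x ⊆ y -> y ∈ k -> x ∈ k.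
Proof.
move=> ok ox xy yk; have [xy'|->//] := ordinal_sub ox (ordinal_mem ok yk) xy.
exact: ordinal_trans xy' yk.
Qed.

Lemma ordinal_succV x : ordinal x -> ordinal (succV x).
Proof.
move=> [tx tex]; split=> y /mem_succV.
  by move=> [yx z zy|-> z zx]; apply/mem_succV; left=> //; apply: tx zy.
by move=> [/tex|->].
Qed.

Lemma ordinal_bigunion x : (forall y, y ∈ x -> ordinal y) -> ordinal (bigunion x).
Proof.
move=> H; split=> y /mem_bigunion [z zx yz].
  by move=> w wy; apply/mem_bigunion; exists z => //; apply: ordinal_trans (H z zx) wy yz.
by case: (H z zx) => _; apply.
Qed.

Lemma ordinal_union x y : ordinal x -> ordinal y -> ordinal (union x y).
Proof. by move=> ox oy; apply: ordinal_bigunion => z /mem_upair [] ->. Qed.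

Lemma ordinal_nat n : ordinal (nat_V n).
Proof.
elim: n => [|n IH] /=; first by split=> y /mem_empty.
exact: ordinal_succV.
Qed.

Lemma mem_omega x : x ∈ omega <-> exists n, x = nat_V n.
Proof. exact: mem_mkV. Qed.

Lemma nat_V_mem m n : m < n -> nat_V m ∈ nat_V n.
Proof.
elim: n => // n IH; rewrite ltnS leq_eqVlt => /orP[/eqP->|/IH mn] /=.
  exact: mem_succV_self.
by apply/mem_succV; left.
Qed.

Lemma nat_V_inj : injective nat_V.
Proof.
move=> m n E; case: (ltngtP m n) => // /nat_V_mem; rewrite E => /memV_irrefl //.
Qed.

(** Lets a sequence indexed by Rocq naturals enter statements about class functions on [omega], such
    as regularity. *)
Lemma nat_V_extend (A : nat -> V) : exists f : V -> V, forall n, f (nat_V n) = A n.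
Proof.
have [|f Hf] := @V_choice (memV^~ omega) (fun x y => forall n, x = nat_V n -> y = A n).
  by move=> x /mem_omega[n ->]; exists (A n) => m /nat_V_inj ->.
by exists f => n; apply: Hf => //; apply/mem_omega; exists n.
Qed.

Lemma ordinal_least (P : V -> Prop) :
  (forall x, P x -> ordinal x) -> (exists x, P x) ->
  exists2 m, P m & forall x, P x -> m ⊆ x.
Proof.
move=> oP [x]; elim/V_ind: x => x IH Px.
have [[y yx Py]|n] := pselect (exists2 y, y ∈ x & P y); first exact: IH Py.
exists x => // y Py; apply: ordinal_memPn; [exact: oP|exact: oP|].
by move=> yx; apply: n; exists y.
Qed.

(** * Functions as sets of ordered pairs *)

Lemma theP (P : V -> Prop) : (exists x, P x) -> P (the P).
Proof. by move=> H; rewrite /the; case: pselect => // h; case: cid. Qed.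

Lemma is_fun_app f a b x : is_fun f a b -> x ∈ a ->
  opair x (app f x) ∈ f /\ app f x ∈ b.
Proof.
move=> [H1 H2] xa; have [y [Hy _]] := H2 x xa.
have H : opair x (app f x) ∈ f by apply: (theP (P := fun y => opair x y ∈ f)); exists y.
by split=> //; have [x' [y' [_ yb /opair_inj[_ ->]]]] := H1 _ H.
Qed.

Lemma is_fun_appE f a b x y : is_fun f a b -> opair x y ∈ f ->
  [/\ x ∈ a, y ∈ b & app f x = y].
Proof.
move=> H Hxy; have [x' [y' [xa yb /opair_inj[Ex Ey]]]] := H.1 _ Hxy.
rewrite Ex Ey; split=> //; have [z [_ uz]] := H.2 _ xa.
by rewrite -(uz (app f x') (is_fun_app H xa).1) -Ey; apply: uz; rewrite -Ex.
Qed.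

Lemma is_fun_ext f g a b b' : is_fun f a b -> is_fun g a b' ->
  (forall x, x ∈ a -> app f x = app g x) -> f = g.
Proof.
suff sub f' g' b1 b2 : is_fun f' a b1 -> is_fun g' a b2 ->
    (forall x, x ∈ a -> app f' x = app g' x) -> f' ⊆ g'.
  move=> Hf Hg E; apply: V_ext => z; split; first exact: (sub _ _ _ _ Hf Hg E).
  by apply: (sub _ _ _ _ Hg Hf) => x /E.
move=> Hf Hg E p pf; have [x [y [xa _ Ep]]] := Hf.1 _ pf.
rewrite Ep in pf *; have [_ _ <-] := is_fun_appE Hf pf.
by rewrite E //; have [] := is_fun_app Hg xa.
Qed.

Definition graph (a : V) (F : V -> V) : V := repl a (fun x => opair x (F x)).

Lemma mem_graph a F x y : opair x y ∈ graph a F <-> x ∈ a /\ y = F x.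
Proof.
rewrite mem_repl; split=> [[z za /opair_inj[-> ->]]//|[xa ->]]; by exists x.
Qed.

Lemma graph_fun a b F : (forall x, x ∈ a -> F x ∈ b) -> is_fun (graph a F) a b.
Proof.
move=> H; split=> [p|x xa].
  by rewrite /graph => /mem_repl[x xa ->]; exists x, (F x); split; auto.
by exists (F x); split=> [|y]; [apply/mem_graph | move/mem_graph => []].
Qed.

Lemma app_graph a F x : x ∈ a -> app (graph a F) x = F x.
Proof.
move=> xa; have H : is_fun (graph a F) a (repl a F).
  by apply: graph_fun => y ya; apply/mem_repl; exists y.
by have [] := is_fun_appE H ((mem_graph a F x (F x)).2 (conj xa erefl)).
Qed.

(** * Pairs as 2-tuples, and binary relations on a set *)

Definition pairV (x y : V) : V := tuple_V [:: x; y].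

Lemma pairVE x y : pairV x y = upair (opair ∅ x) (opair (nat_V 1) y).
Proof.
apply: V_ext => z; rewrite mem_upair mem_mkV; split.
  by move=> [[[|[|//]] i] ->]; [left | right].
have l0 : 0 < 2 by []. have l1 : 1 < 2 by [].
by case=> ->; [exists (exist _ 0 l0) | exists (exist _ 1 l1)].
Qed.

Lemma pairV_inj x y z w : pairV x y = pairV z w -> x = z /\ y = w.
Proof.
have n01 : ∅ <> nat_V 1 by move=> /(@nat_V_inj 0 1).
move=> E; split.
  have : opair ∅ x ∈ pairV z w by rewrite -E pairVE; apply/mem_upair; left.
  by rewrite pairVE => /mem_upair[] /opair_inj[].
have : opair (nat_V 1) y ∈ pairV z w by rewrite -E pairVE; apply/mem_upair; right.
by rewrite pairVE => /mem_upair[] /opair_inj[] // /esym.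
Qed.

Lemma mem_nat1 x : x ∈ nat_V 1 <-> x = ∅.
Proof. by rewrite /= mem_adjoin; split=> [[/mem_empty|]|]; auto. Qed.

Lemma mem_nat2 x : x ∈ nat_V 2 <-> x = ∅ \/ x = nat_V 1.
Proof. by rewrite [nat_V 2]/= mem_adjoin -/(nat_V 1) -mem_nat1. Qed.

Lemma is_tuple2 a t : is_tuple 2 a t <-> exists x y, [/\ x ∈ a, y ∈ a & t = pairV x y].
Proof.
split=> [H|[x [y [xa ya ->]]]].
  have m0 : ∅ ∈ nat_V 2 by apply/mem_nat2; left.
  have m1 : nat_V 1 ∈ nat_V 2 by apply/mem_nat2; right.
  exists (app t ∅), (app t (nat_V 1)); split; try exact: (is_fun_app H _).2.
  apply: V_ext => z; rewrite pairVE mem_upair; split=> [zt|].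
    have [x [y [/mem_nat2 x2 ya E]]] := H.1 _ zt.
    by rewrite E in zt *; have [_ _ <-] := is_fun_appE H zt; case: x2 => ->; auto.
  by case=> ->; exact: (is_fun_app H _).1.
rewrite pairVE; split=> [p /mem_upair[]->|z /mem_nat2 []->].
- by exists ∅, x; split=> //; apply/mem_nat2; left.
- by exists (nat_V 1), y; split=> //; apply/mem_nat2; right.
- exists x; split; first by apply/mem_upair; left.
  by move=> w /mem_upair[] /opair_inj[] // /(@nat_V_inj 0 1).
- exists y; split; first by apply/mem_upair; right.
  by move=> w /mem_upair[] /opair_inj[] // /(@nat_V_inj 1 0).
Qed.

(* 2-tuples are not Kuratowski pairs: this is the shape of the interpretations of
   the predicate symbols. *)
Definition relV (a : V) (r : V -> V -> Prop) : V :=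
  bigunion (repl a (fun x => repl (sep a (r x)) (pairV x))).

Lemma mem_relV a r x y : pairV x y ∈ relV a r <-> [/\ x ∈ a, y ∈ a & r x y].
Proof.
rewrite mem_bigunion; split.
  by move=> [_ /mem_repl[x' xa ->] /mem_repl[y' /mem_sep[ya rxy] /pairV_inj[-> ->]]].
move=> [xa ya rxy]; exists (repl (sep a (r x)) (pairV x)); apply/mem_repl; [by exists x|].
by exists y => //; apply/mem_sep.
Qed.

Lemma relV_pair a r t : t ∈ relV a r -> exists x y, [/\ x ∈ a, y ∈ a, r x y & t = pairV x y].
Proof.
by move=> /mem_bigunion [_ /mem_repl[x xa ->] /mem_repl[y /mem_sep[ya rxy] ->]]; exists x, y.
Qed.

Lemma relV_on a r : rel_on 2 a (relV a r).
Proof. by move=> t /relV_pair[x [y [xa ya _ ->]]]; apply/is_tuple2; exists x, y. Qed.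

Lemma relV_restr a b r : a ⊆ b -> sep (relV b r) (is_tuple 2 a) = relV a r.
Proof.
move=> ab; apply: V_ext => t; rewrite mem_sep; split.
  move=> [tr /is_tuple2[x [y [xa ya E]]]]; move: tr; rewrite E.
  by move=> /mem_relV[_ _ rxy]; apply/mem_relV.
move=> /relV_pair[x [y [xa ya rxy ->]]]; split; first by apply/mem_relV; split; auto.
by apply/is_tuple2; exists x, y.
Qed.

(** * Pairing and clubs on a regular cardinal *)

(** Recursion along [∈]. The step sees only the set of earlier values and the argument, which is
    enough for ordinal arithmetic and for unions of values. *)
Definition recV (G : V -> V -> V) : V -> V :=
  Fix memV_wf (fun _ => V)
    (fun z rec => G (mkV (fun a : idx z => rec (elt a) (mem_elt a))) z).

Lemma recVE G z : recV G z = G (repl z (recV G)) z.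
Proof.
rewrite /recV Fix_eq // => x f g E; congr (G _ x); congr (mkV _).
by apply/funext => a; apply: E.
Qed.

Section Regular.
Context (k : V) (hk : regular_uncountable k).

Lemma regular_ordinal : ordinal k.
Proof. by case: hk => -[]. Qed.

Lemma mem_regular_ordinal x : x ∈ k -> ordinal x.
Proof. exact: ordinal_mem regular_ordinal. Qed.

Lemma regular_trans x y : x ∈ y -> y ∈ k -> x ∈ k.
Proof. exact: ordinal_trans regular_ordinal. Qed.

Lemma regular_sub x y : ordinal x -> x ⊆ y -> y ∈ k -> x ∈ k.
Proof. exact: ordinal_sub_mem regular_ordinal. Qed.

Lemma nat_V_regular n : nat_V n ∈ k.
Proof. by case: hk => _ ok _; apply: regular_trans ok; apply/mem_omega; exists n. Qed.

Lemma succV_regular x : x ∈ k -> succV x ∈ k.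
Proof.
move=> xk; case: (hk) => _ _ reg.
(* Closure under successor comes from regularity: the constant function [x] on a one-element ordinal
   has a bound [c] in [k] with [x ∈ c]. *)
have [c ck H] := reg (nat_V 1) (fun _ => x) (nat_V_regular 1) (fun _ _ => xk).
have xc : x ∈ c by apply: (H ∅); apply/mem_nat1.
apply: (regular_sub _ _ ck); first by apply: ordinal_succV; apply: mem_regular_ordinal.
by move=> y /mem_succV[yx|-> //]; apply: ordinal_trans yx xc; apply: mem_regular_ordinal.
Qed.

Lemma bigunion_regular b f : b ∈ k -> (forall x, x ∈ b -> f x ∈ k) ->
  bigunion (repl b f) ∈ k.
Proof.
move=> bk H; case: (hk) => _ _ reg; have [c ck Hc] := reg b f bk H.
apply: (regular_sub _ _ ck).
  by apply: ordinal_bigunion => y /mem_repl[x xb ->]; apply/mem_regular_ordinal/H.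
move=> z /mem_bigunion[y /mem_repl[x /Hc fc ->] zf].
exact: ordinal_trans (mem_regular_ordinal ck) zf fc.
Qed.

Lemma union_regular x y : x ∈ k -> y ∈ k -> union x y ∈ k.
Proof.
move=> xk yk; have ox := mem_regular_ordinal xk; have oy := mem_regular_ordinal yk.
have [xy|->|yx] := ordinal_trichotomy ox oy.
- apply: (regular_sub _ _ yk); first exact: ordinal_union.
  by move=> z /mem_union[zx|//]; apply: ordinal_trans zx xy.
- by apply: regular_sub yk; [apply: ordinal_union | move=> z /mem_union[]].
- apply: (regular_sub _ _ xk); first exact: ordinal_union.
  by move=> z /mem_union[//|zy]; apply: ordinal_trans zy yx.
Qed.

(** * Ordinal addition and an injective pairing function on [k] *)

Definition addV (x y : V) : V := recV (fun r _ => union x r) y.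

Lemma mem_addV x y z : z ∈ addV x y <-> z ∈ x \/ exists2 u, u ∈ y & z = addV x u.
Proof. by rewrite /addV recVE mem_union mem_repl. Qed.

Lemma addV_mono x y u : u ∈ y -> addV x u ∈ addV x y.
Proof. by move=> uy; apply/mem_addV; right; exists u. Qed.

Lemma addV_regular x y : x ∈ k -> y ∈ k -> addV x y ∈ k.
Proof.
move=> xk; elim/V_ind: y => y IH yk.
have Hs u : u ∈ y -> succV (addV x u) ∈ k.
  by move=> uy; apply: succV_regular; apply: IH => //; apply: regular_trans yk.
have := union_regular xk (bigunion_regular yk Hs).
suff -> : addV x y = union x (bigunion (repl y (fun u => succV (addV x u)))) by [].
apply: V_ext => z; rewrite mem_addV mem_union mem_bigunion; split.
  case=> [|[u uy ->]]; [by left | right; exists (succV (addV x u))].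
    by apply/mem_repl; exists u.
  exact: mem_succV_self.
case=> [|[_ /mem_repl[u uy ->] /mem_succV[/mem_addV[]|->]]]; first by left.
- by left.
- move=> [w wu ->]; right; exists w => //.
  exact: ordinal_trans (mem_regular_ordinal yk) wu uy.
- by right; exists u.
Qed.

Lemma addV_inj x y z : y ∈ k -> z ∈ k -> addV x y = addV x z -> y = z.
Proof.
move=> yk zk E.
have [yz|//|zy] := ordinal_trichotomy (mem_regular_ordinal yk) (mem_regular_ordinal zk).
  by have := addV_mono x yz; rewrite E => /memV_irrefl.
by have := addV_mono x zy; rewrite E => /memV_irrefl.
Qed.

(* The block of [m] has room for the pairs [(m, e)], [e < m], followed by the
   pairs [(e, m)], [e <= m]. *)
Definition blockV (s m : V) : V := addV (addV s m) (succV m).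

(** Blocks are laid end to end: each one starts at the supremum of the ends of the earlier ones. *)
Definition endV : V -> V := recV (fun r m => blockV (bigunion r) m).
Definition startV (m : V) : V := bigunion (repl m endV).

Lemma endVE m : endV m = blockV (startV m) m.
Proof. by rewrite /endV recVE. Qed.

Lemma endV_regular m : m ∈ k -> endV m ∈ k.
Proof.
elim/V_ind: m => m IH mk; rewrite endVE; apply: addV_regular; last exact: succV_regular.
apply: addV_regular => //; apply: bigunion_regular => // x xm; apply: IH => //.
exact: regular_trans mk.
Qed.

Lemma startV_regular m : m ∈ k -> startV m ∈ k.
Proof.
move=> mk; apply: bigunion_regular => // x xm; apply: endV_regular.
exact: regular_trans mk.
Qed.

Lemma endV_sub_startV m n : m ∈ n -> endV m ⊆ startV n.
Proof. by move=> mn z zm; apply/mem_bigunion; exists (endV m) => //; apply/mem_repl; exists m. Qed.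

Lemma addV_sub x y : x ⊆ addV x y.
Proof. by move=> z zx; apply/mem_addV; left. Qed.

Lemma addV_startV_endV m e : e ∈ m -> addV (startV m) e ∈ endV m.
Proof. by move=> em; rewrite endVE; apply/addV_sub/addV_mono. Qed.

Lemma addV_midV_endV m e : e ∈ succV m -> addV (addV (startV m) m) e ∈ endV m.
Proof. by move=> em; rewrite endVE; apply: addV_mono. Qed.

Definition codeV (x y : V) : V :=
  if `[< y ∈ x >] then addV (startV x) y else addV (addV (startV y) y) x.

Lemma codeV_regular x y : x ∈ k -> y ∈ k -> codeV x y ∈ k.
Proof.
move=> xk yk; rewrite /codeV; case: asboolP => _.
  by apply: addV_regular => //; apply: startV_regular.
by apply: addV_regular => //; apply: addV_regular => //; apply: startV_regular.
Qed.

(** Blocks are disjoint, since the end of an earlier block is contained in the start of every later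
    one. *)
Lemma block_inj m n z : m ∈ k -> n ∈ k ->
  startV m ⊆ z -> z ∈ endV m -> startV n ⊆ z -> z ∈ endV n -> m = n.
Proof.
have disj u v : z ∈ endV u -> startV v ⊆ z -> ~ u ∈ v.
  by move=> zu vz /endV_sub_startV uv; apply: (@memV_irrefl z); apply/vz/uv.
move=> mk nk sm em sn en.
have [mn|//|nm] := ordinal_trichotomy (mem_regular_ordinal mk) (mem_regular_ordinal nk).
  by case: (disj _ _ em sn).
by case: (disj _ _ en sm).
Qed.

(** The block containing a code gives the larger coordinate [m], and the offset in the block gives
    the other one; the midpoint [addV (startV m) m] separates the pairs with strictly larger first
    coordinate from the rest. *)
Lemma codeV_inj x y x' y' : x ∈ k -> y ∈ k -> x' ∈ k -> y' ∈ k ->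
  codeV x y = codeV x' y' -> x = x' /\ y = y'.
Proof.
have mid u e e' : e ∈ u -> addV (startV u) e <> addV (addV (startV u) u) e'.
  move=> eu E; have := addV_mono (startV u) eu; rewrite E => H.
  by apply: (@memV_irrefl (addV (addV (startV u) u) e')); apply: addV_sub.
have le u v : u ∈ k -> v ∈ k -> ~ v ∈ u -> u ∈ succV v.
  move=> uk vk vu; apply/mem_succV; apply: ordinal_sub; try exact: mem_regular_ordinal.
  by apply: ordinal_memPn vu; apply: mem_regular_ordinal.
have sub2 u v w : u ⊆ addV (addV u v) w by move=> z zu; do 2 apply: addV_sub.
move=> xk yk xk' yk'; rewrite /codeV.
case: asboolP => yx; case: asboolP => yx' E.
- have E1 := addV_startV_endV yx; have E2 := addV_startV_endV yx'.
  rewrite -E in E2.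
  have S2 := @addV_sub (startV x') y'; rewrite -E in S2.
  have xx := block_inj xk xk' (@addV_sub _ _) E1 S2 E2.
  by split=> //; move: E; rewrite -xx; apply: addV_inj.
- have E1 := addV_startV_endV yx; have E2 := addV_midV_endV (le _ _ xk' yk' yx').
  rewrite -E in E2.
  have S2 := @sub2 (startV y') y' x'; rewrite -E in S2.
  have xy := block_inj xk yk' (@addV_sub _ _) E1 S2 E2.
  by case: (mid x y x') => //; rewrite E xy.
- have E1 := addV_startV_endV yx'; have E2 := addV_midV_endV (le _ _ xk yk yx).
  rewrite E in E2.
  have S2 := @sub2 (startV y) y x; rewrite E in S2.
  have xy := block_inj xk' yk (@addV_sub _ _) E1 S2 E2.
  by case: (mid x' y' x) => //; rewrite -E xy.
- have E1 := addV_midV_endV (le _ _ xk yk yx).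
  have E2 := addV_midV_endV (le _ _ xk' yk' yx').
  rewrite -E in E2.
  have S2 := @sub2 (startV y') y' x'; rewrite -E in S2.
  have yy := block_inj yk yk' (@sub2 _ _ _) E1 S2 E2.
  by split=> //; move: E; rewrite -yy; apply: addV_inj.
Qed.

(* The closure points of a function on [k] form a club, and every club contains
   the closure points of some function. *)
Definition closed_under (h : V -> V) (a : V) : Prop :=
  a <> ∅ /\ forall x, x ∈ a -> h x ∈ a.

Definition clubly (P : V -> Prop) : Prop :=
  exists2 h : V -> V, forall x, x ∈ k -> h x ∈ k &
    forall a, a ∈ k -> closed_under h a -> P a.

Lemma clublyW P Q : clubly P -> (forall a, a ∈ k -> a <> ∅ -> P a -> Q a) -> clubly Q.
Proof. by move=> [h hk' H] PQ; exists h => // a ak c; apply: PQ (H _ ak c); case: c. Qed.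

Lemma empty_mem a : a ∈ k -> a <> ∅ -> ∅ ∈ a.
Proof.
move=> ak an.
have [//|ae|/mem_empty//] := ordinal_trichotomy (ordinal_nat 0) (mem_regular_ordinal ak).
by case: an.
Qed.

(** The one-place function [b x] exceeds [h y z] for all [y, z <= x]; an ordinal closed under [b] is
    closed under [h], by looking at the larger argument. *)
Lemma clubly_binary (h : V -> V -> V) :
  (forall x y, x ∈ k -> y ∈ k -> h x y ∈ k) ->
  clubly (fun a => forall x y, x ∈ a -> y ∈ a -> h x y ∈ a).
Proof.
move=> Hh.
pose b x := bigunion (repl (succV x) (fun y =>
  bigunion (repl (succV x) (fun z => succV (h y z))))).
have bk x : x ∈ k -> b x ∈ k.
  move=> xk; have sk := succV_regular xk.
  apply: bigunion_regular => // y yx; apply: bigunion_regular => // z zx.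
  by apply: succV_regular; apply: Hh; apply: regular_trans sk.
exists b => // a ak [_ ca] x y xa ya.
have oa := mem_regular_ordinal ak.
have ox := ordinal_mem oa xa; have oy := ordinal_mem oa ya.
have [m [ma xm ym]] : exists m, [/\ m ∈ a, x ∈ succV m & y ∈ succV m].
  have [xy|xy|yx] := ordinal_trichotomy ox oy.
  - by exists y; split=> //; apply/mem_succV; auto.
  - by exists y; split=> //; apply/mem_succV; auto.
  - by exists x; split=> //; apply/mem_succV; auto.
apply: (ordinal_trans oa _ (ca m ma)); apply/mem_bigunion.
exists (bigunion (repl (succV m) (fun z => succV (h x z)))); first by apply/mem_repl; exists x.
apply/mem_bigunion; exists (succV (h x y)); last exact: mem_succV_self.
by apply/mem_repl; exists y.
Qed.

Lemma clubly_unary (h : V -> V) :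
  (forall x, x ∈ k -> h x ∈ k) -> clubly (fun a => forall x, x ∈ a -> h x ∈ a).
Proof. by move=> H; exists h => // a _ []. Qed.

Lemma clublyI P Q : clubly P -> clubly Q -> clubly (fun a => P a /\ Q a).
Proof.
move=> [f fk Pf] [g gk Qg].
have Hu x : x ∈ k -> union (f x) (g x) ∈ k by move=> xk; apply: union_regular; auto.
apply: (clublyW (clubly_unary Hu)) => a ak an ca.
have oa := mem_regular_ordinal ak.
have ak' x : x ∈ a -> x ∈ k by move=> xa; apply: regular_trans ak.
split; [apply: Pf | apply: Qg] => //; split=> // x xa.
  apply: (ordinal_sub_mem oa _ _ (ca x xa)) => [|z zx]; last by apply/mem_union; left.
  by apply: mem_regular_ordinal; apply: fk; apply: ak'.
apply: (ordinal_sub_mem oa _ _ (ca x xa)) => [|z zx]; last by apply/mem_union; right.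
by apply: mem_regular_ordinal; apply: gk; apply: ak'.
Qed.

(** Diagonal intersection: with a function [h b] chosen for each [b], an ordinal closed under the
    binary [h] is closed under [h b] for each of its elements [b]. *)
Lemma clubly_diag (P : V -> V -> Prop) :
  (forall b, b ∈ k -> clubly (P b)) -> clubly (fun a => forall b, b ∈ a -> P b a).
Proof.
move=> H.
have [h Hh] : exists h : V -> V -> V, forall b, b ∈ k ->
    (forall x, x ∈ k -> h b x ∈ k) /\
    (forall a, a ∈ k -> closed_under (h b) a -> P b a).
  have [|h Hh] := @choice V (V -> V) (fun b h => b ∈ k -> (forall x, x ∈ k -> h x ∈ k) /\
    (forall a, a ∈ k -> closed_under h a -> P b a)); last by exists h.
  move=> b; have [bk|nb] := pselect (b ∈ k); last by exists id.
  by have [h] := H b bk; exists h.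
have Hk x y : x ∈ k -> y ∈ k -> h x y ∈ k by move=> xk yk; apply: (Hh x xk).1.
apply: (clublyW (clubly_binary Hk)) => a ak an ca b ba.
apply: (Hh b (regular_trans ba ak)).2 => //; split=> // x xa; exact: ca.
Qed.

Lemma clubly_above x : x ∈ k -> clubly (fun a => x ∈ a).
Proof.
move=> xk; exists (fun _ => x) => // a ak [an ca].
by apply: (ca ∅); apply: empty_mem.
Qed.

(** With [h] picking an element of [C] above each point, a closure point of [h] is a limit of [C],
    hence belongs to [C]. *)
Lemma clubly_club C : club k C -> clubly (fun a => a ∈ C).
Proof.
move=> [Ck unb lim].
have [h Hh] : exists h : V -> V, forall b, b ∈ k -> h b ∈ C /\ b ∈ h b.
  by apply: (@V_choice (memV^~ k) (fun b c => c ∈ C /\ b ∈ c)) => b /unb [c cC bc]; exists c.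
exists h => [x xk|a ak [an ca]]; first by apply: Ck; case: (Hh x xk).
apply: lim => // b ba; exists (h b).
by have [] := Hh b (regular_trans ba ak); split=> //; apply: ca.
Qed.

Lemma clubly_exists_club P : clubly P -> exists2 C, club k C & forall a, a ∈ C -> P a.
Proof.
move=> [h hk' HP]; exists (sep k (closed_under h)); last by move=> a /mem_sep[]; apply: HP.
split.
- by move=> x /mem_sep[].
- move=> b bk.
  (* One step passes [x] and every [h y] with [y] below [x]. The union of the iterates starting
     above [b] is a closure point, and lies in [k] by regularity since [omega ∈ k]. *)
  pose step x := union (succV x) (bigunion (repl x (fun y => succV (h y)))).
  have stepk x : x ∈ k -> step x ∈ k.
    move=> xk; apply: union_regular; first exact: succV_regular.
    apply: bigunion_regular => // y yx; apply/succV_regular/hk'; exact: regular_trans xk.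
  pose it n := iter n step (succV b).
  have itk n : it n ∈ k by elim: n => [|n IH]; [apply: succV_regular | apply: stepk].
  pose a := mkV (fun p : {n : nat & idx (it n)} => elt (tagged p)).
  have mem_a z : z ∈ a <-> exists n, z ∈ it n.
    rewrite mem_mkV; split=> [[[n i] ->]|[n [i ->]]]; first by exists n; apply: mem_elt.
    by exists (Tagged (fun n => idx (it n)) i).
  have ak : a ∈ k.
    have [f Hf] := nat_V_extend it.
    have ok : omega ∈ k by case: hk.
    suff -> : a = bigunion (repl omega f).
      by apply: bigunion_regular => // x /mem_omega[n ->]; rewrite Hf.
    apply: V_ext => z; rewrite mem_a mem_bigunion; split.
      move=> [n zn]; exists (it n) => //; apply/mem_repl; exists (nat_V n) => //.
      by apply/mem_omega; exists n.
    by move=> [_ /mem_repl[_ /mem_omega[n ->] ->]]; rewrite Hf; exists n.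
  have ba : b ∈ a by apply/mem_a; exists 0; apply: mem_succV_self.
  exists a => //; apply/mem_sep; split=> //; split=> [E|x /mem_a[n xn]].
    by move: ba; rewrite E => /mem_empty.
  apply/mem_a; exists n.+1; rewrite /it iterS -/(it n).
  apply/mem_union; right; apply/mem_bigunion; exists (succV (h x)).
    by apply/mem_repl; exists x.
  exact: mem_succV_self.
- move=> d dk dn lim; apply/mem_sep; split=> //; split=> // x xd.
  have [c [/mem_sep[_ [_ ch]] cd xc]] := lim x xd.
  exact: ordinal_trans (mem_regular_ordinal dk) (ch x xc) cd.
Qed.

Lemma stationary_clubly T P : stationary k T -> clubly P -> exists2 a, a ∈ T & P a.
Proof.
move=> [_ sT] /clubly_exists_club[C cC CP]; have [a aC aT] := sT C cC.
by exists a => //; apply: CP.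
Qed.

Lemma nonstationary_clubly T : T ⊆ k -> ~ stationary k T -> clubly (fun a => ~ a ∈ T).
Proof.
move=> Tk nT; apply: contrapT => nC; apply: nT; split=> // C cC.
apply: contrapT => H; apply: nC; apply: (clublyW (clubly_club cC)) => a _ _ aC aT.
by apply: H; exists a.
Qed.

End Regular.

(** * Closure of p.r.-closed sets *)

Lemma prim_rec_nth n i : i < n -> prim_rec (fun t : n.-tuple V => nth ∅ t i).
Proof.
move=> i_n; have := PR_proj (Ordinal i_n).
by congr prim_rec; apply/funext => t; rewrite (tnth_nth ∅).
Qed.

Lemma prim_rec_comp n p (F : p.-tuple V -> V) (h : seq (n.-tuple V -> V)) :
  prim_rec F -> size h = p -> (forall i, i < p -> prim_rec (nth (fun _ => ∅) h i)) ->
  prim_rec (fun t => F [tuple nth (fun _ => ∅) h i t | i < p]).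
Proof. by move=> HF sh Hh; apply: (PR_comp (H := fun i : 'I_p => nth _ h i)) => // i; apply: Hh. Qed.

Section PrimRecCombinators.
Context (n : nat).
Implicit Types h : n.-tuple V -> V.

Lemma nth_comp p (h : seq (n.-tuple V -> V)) t i (i_p : i < p) :
  nth ∅ [tuple nth (fun _ => ∅) h j t | j < p] i = nth (fun _ => ∅) h i t.
Proof. by rewrite -[i]/(val (Ordinal i_p)) -tnth_nth tnth_mktuple. Qed.

Lemma prim_rec_adjoin h0 h1 : prim_rec h0 -> prim_rec h1 ->
  prim_rec (fun t => adjoin (h0 t) (h1 t)).
Proof.
move=> P0 P1; have := @prim_rec_comp n 2 _ [:: h0; h1] PR_adjoin erefl.
have -> : (fun t : n.-tuple V => adjoin (h0 t) (h1 t)) =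
    (fun t => (fun x : 2.-tuple V => adjoin (nth ∅ x 0) (nth ∅ x 1))
       [tuple nth (fun _ => ∅) [:: h0; h1] i t | i < 2]).
  by apply/funext => t; rewrite !nth_comp.
by apply=> -[|[|]].
Qed.

Lemma prim_rec_if h0 h1 h2 h3 : prim_rec h0 -> prim_rec h1 -> prim_rec h2 -> prim_rec h3 ->
  prim_rec (fun t => if `[< h2 t ∈ h3 t >] then h0 t else h1 t).
Proof.
move=> P0 P1 P2 P3; have := @prim_rec_comp n 4 _ [:: h0; h1; h2; h3] PR_cond erefl.
have -> : (fun t : n.-tuple V => if `[< h2 t ∈ h3 t >] then h0 t else h1 t) =
    (fun t => (fun x : 4.-tuple V =>
      if `[< nth ∅ x 2 ∈ nth ∅ x 3 >] then nth ∅ x 0 else nth ∅ x 1)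
       [tuple nth (fun _ => ∅) [:: h0; h1; h2; h3] i t | i < 4]).
  by apply/funext => t; rewrite !nth_comp.
by apply=> -[|[|[|[|]]]].
Qed.

Lemma upair_adjoin x y : upair x y = adjoin (adjoin ∅ x) y.
Proof.
apply: V_ext => z; rewrite mem_upair !mem_adjoin.
by split=> [[]|[[/mem_empty|]|]]; auto.
Qed.

Lemma prim_rec_upair h0 h1 : prim_rec h0 -> prim_rec h1 ->
  prim_rec (fun t => upair (h0 t) (h1 t)).
Proof.
move=> P0 P1; rewrite (_ : (fun t => _) = (fun t => adjoin (adjoin ∅ (h0 t)) (h1 t))).
  by do !apply: prim_rec_adjoin => //; apply: PR_zero.
by apply/funext => t; apply: upair_adjoin.
Qed.

Lemma prim_rec_opair h0 h1 : prim_rec h0 -> prim_rec h1 ->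
  prim_rec (fun t => opair (h0 t) (h1 t)).
Proof. by move=> P0 P1; do !apply: prim_rec_upair. Qed.

Lemma prim_rec_nat_V m : prim_rec (fun _ : n.-tuple V => nat_V m).
Proof. by elim: m => [|m IH]; [apply: PR_zero | apply: prim_rec_adjoin]. Qed.

Lemma prim_rec_pairV h0 h1 : prim_rec h0 -> prim_rec h1 ->
  prim_rec (fun t => pairV (h0 t) (h1 t)).
Proof.
move=> P0 P1; rewrite (_ : (fun t => _) = (fun t => upair (opair ∅ (h0 t)) (opair (nat_V 1) (h1 t)))).
  by apply: prim_rec_upair; apply: prim_rec_opair => //; [apply: PR_zero | apply: (prim_rec_nat_V 1)].
by apply/funext => t; apply: pairVE.
Qed.

End PrimRecCombinators.

(** Primitive recursiveness of a curried function, stated as preservation under substitution so that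
    no argument tuple has to be rebuilt. *)
Definition prim_rec3 (g : V -> V -> V -> V) : Prop :=
  forall n (h0 h1 h2 : n.-tuple V -> V), prim_rec h0 -> prim_rec h1 -> prim_rec h2 ->
    prim_rec (fun t => g (h0 t) (h1 t) (h2 t)).

(* The recursion schema only accumulates unions of its own values, whereas
   [U_{u in z} g(u)] is not of that form; with a parameter [q] one recurses on
   [F z q = if z in q then g z else U_{u in z} F u q], and takes [q = z]. *)
Definition bigcup_rec (g : V -> V -> V -> V) (z q x y : V) : V :=
  recV (fun r u => if `[< u ∈ q >] then g u x y else bigunion r) z.

Lemma bigcup_recE g z q x y : bigcup_rec g z q x y =
  if `[< z ∈ q >] then g z x y
  else bigunion (repl z (fun u => bigcup_rec g u q x y)).
Proof. by rewrite /bigcup_rec recVE. Qed.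

Lemma bigcup_rec_diag g z x y : bigcup_rec g z z x y = bigunion (repl z (fun u => g u x y)).
Proof.
rewrite bigcup_recE; case: asboolP => [/memV_irrefl//|_]; congr bigunion.
apply: V_ext => w; rewrite !mem_repl; split=> -[u uz ->]; exists u => //;
  by rewrite bigcup_recE; case: asboolP.
Qed.

Lemma prim_rec_bigcup g : prim_rec3 g -> prim_rec (fun t : 4.-tuple V =>
  bigcup_rec g (nth ∅ t 0) (nth ∅ t 1) (nth ∅ t 2) (nth ∅ t 3)).
Proof.
(* Position 0 holds the union of the values at the elements of the recursion argument, position 1
   that argument, and positions 2, 3, 4 hold [q], [x], [y]. *)
move=> Hg; apply: (@PR_rec 3 (fun t : 5.-tuple V => if `[< nth ∅ t 1 ∈ nth ∅ t 2 >]
   then g (nth ∅ t 1) (nth ∅ t 3) (nth ∅ t 4) else nth ∅ t 0)).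
  by apply: prim_rec_if; try exact: prim_rec_nth; apply: Hg; apply: prim_rec_nth.
by move=> z x; rewrite /= bigcup_recE.
Qed.

Section PrClosed.
Context (N : V) (prN : pr_closed N).

Lemma pr_closed0 : ∅ ∈ N.
Proof. by apply: (prN (PR_zero 0) (x := [tuple])); case. Qed.

Lemma pr_closed_adjoin x y : x ∈ N -> y ∈ N -> adjoin x y ∈ N.
Proof. by move=> xN yN; apply: (prN PR_adjoin (x := [tuple x; y])) => -[[|[|//]] i]. Qed.

Lemma pr_closed_nat n : nat_V n ∈ N.
Proof. by elim: n => [|n IH]; [apply: pr_closed0 | apply: pr_closed_adjoin]. Qed.

Lemma pr_closed_upair x y : x ∈ N -> y ∈ N -> upair x y ∈ N.
Proof.
by move=> xN yN; rewrite upair_adjoin; do !apply: pr_closed_adjoin => //; apply: pr_closed0.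
Qed.

Lemma pr_closed_bigcup g z x y : prim_rec3 g -> z ∈ N -> x ∈ N -> y ∈ N ->
  bigunion (repl z (fun u => g u x y)) ∈ N.
Proof.
move=> Hg zN xN yN; rewrite -bigcup_rec_diag.
by apply: (prN (prim_rec_bigcup Hg) (x := [tuple z; z; x; y])) => -[[|[|[|[|//]]]] i].
Qed.

Lemma pr_closed_union x y : x ∈ N -> y ∈ N -> union x y ∈ N.
Proof.
move=> xN yN; suff -> : union x y = bigunion (repl (upair x y) (fun u => u)).
  apply: (pr_closed_bigcup (g := fun u _ _ => u) (x := ∅) (y := ∅));
    by [ | apply: pr_closed_upair | apply: pr_closed0 ].
congr bigunion; apply: V_ext => z; rewrite mem_repl.
by split=> [zx|[u ux ->//]]; exists z.
Qed.

(** For [t] in [a] this is a union over [u] in [a] of singletons or empty sets, the shape handled by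
    [pr_closed_bigcup]; otherwise it is empty. *)
Lemma pr_closed_slice a t X : transitive_set N -> a ∈ N -> t ∈ N -> X ∈ N ->
  relV a (fun s e => s = t /\ e ∈ X) ∈ N.
Proof.
move=> tN aN tN' XN; set Y := relV _ _.
pose g u t X := if `[< u ∈ X >] then upair (pairV t u) (pairV t u) else ∅.
have [ta|nta] := pselect (t ∈ a); last first.
  suff -> : Y = ∅ by apply: pr_closed0.
  apply: V_ext => p; split=> [/relV_pair[s [e [sa _ [st _] _]]]|/mem_empty//].
  by case: nta; rewrite -st.
suff -> : Y = bigunion (repl a (fun u => g u t X)).
  apply: pr_closed_bigcup => //.
  move=> n h0 h1 h2 P0 P1 P2; apply: prim_rec_if => //; last exact: PR_zero.
  by apply: prim_rec_upair; apply: prim_rec_pairV.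
apply: V_ext => p; rewrite mem_bigunion; split.
  move=> /relV_pair[s [e [sa ea [-> eX] ->]]]; exists (g e t X); first by apply/mem_repl; exists e.
  by rewrite /g; case: asboolP => // _; apply/mem_upair; left.
move=> [_ /mem_repl[u ua ->]]; rewrite /g; case: asboolP => [uX|_ /mem_empty//].
by move=> /mem_upair[] ->; apply/mem_relV.
Qed.

(** Packs a finite list of sets into one binary relation on [a], so that a single second-order
    variable of arity 2 carries several subsets of [a]. *)
Definition slices (a : V) (Xs : seq V) : V :=
  relV a (fun s e => exists2 t, s = nat_V t & e ∈ nth ∅ Xs t).

Lemma mem_slices a Xs t e : nat_V t ∈ a -> e ∈ a ->
  pairV (nat_V t) e ∈ slices a Xs <-> e ∈ nth ∅ Xs t.
Proof.
move=> ta ea; rewrite mem_relV; split=> [[_ _ [t' /nat_V_inj ->]]//|H].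
by split=> //; exists t.
Qed.

Lemma pr_closed_slices a Xs : transitive_set N -> a ∈ N -> (forall t, nth ∅ Xs t ∈ N) ->
  slices a Xs ∈ N.
Proof.
move=> tN aN; elim/last_ind: Xs => [_|Xs X IH H].
  suff -> : slices a [::] = ∅ by apply: pr_closed0.
  apply: V_ext => p; split=> [/relV_pair[s [e [_ _ [t _]]]]|/mem_empty//].
  by rewrite nth_nil => /mem_empty.
have XN : X ∈ N by have := H (size Xs); rewrite nth_rcons ltnn eqxx.
have XsN t : nth ∅ Xs t ∈ N.
  have := H t; rewrite nth_rcons; case: ltnP => // sz _.
  by rewrite nth_default //; apply: pr_closed0.
suff -> : slices a (rcons Xs X) =
    union (slices a Xs) (relV a (fun s e => s = nat_V (size Xs) /\ e ∈ X)).
  by apply: pr_closed_union; [apply: IH | apply: pr_closed_slice => //; apply: pr_closed_nat].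
apply: V_ext => p; rewrite mem_union; split.
  move=> /relV_pair[s [e [sa ea [t Es H'] ->]]]; rewrite Es in sa *; move: H'; rewrite nth_rcons.
  case: ltngtP => [_ eX|_ /mem_empty//|E eX]; [left | right]; apply/mem_relV.
    by split=> //; exists t.
  by rewrite E in sa *; split.
case=> /relV_pair[s [e [sa ea H' ->]]]; apply/mem_relV; split=> //.
  case: H' => t -> eX; exists t => //; rewrite nth_rcons; case: ltnP => // sz.
  by move: eX; rewrite nth_default // => /mem_empty.
by case: H' => -> eX; exists (size Xs) => //; rewrite nth_rcons ltnn eqxx.
Qed.

Definition section (a t Y : V) : V := sep a (fun e => pairV t e ∈ Y).

Lemma pr_closed_section a t Y : a ∈ N -> t ∈ N -> Y ∈ N -> section a t Y ∈ N.
Proof.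
move=> aN ta YN.
pose g u t Y := if `[< pairV t u ∈ Y >] then upair u u else ∅.
suff -> : section a t Y = bigunion (repl a (fun u => g u t Y)).
  apply: pr_closed_bigcup => // n h0 h1 h2 P0 P1 P2.
  by apply: prim_rec_if => //; [apply: prim_rec_upair|apply: PR_zero|apply: prim_rec_pairV].
apply: V_ext => p; rewrite mem_bigunion mem_sep; split.
  move=> [pa pY]; exists (g p t Y); first by apply/mem_repl; exists p.
  by rewrite /g; case: asboolP => // _; apply/mem_upair; left.
move=> [_ /mem_repl[u ua ->]]; rewrite /g; case: asboolP => [uX|_ /mem_empty//].
by move=> /mem_upair[] ->.
Qed.

End PrClosed.

(** * Sets of hereditary cardinality at most [k] *)

Lemma Cantor_BernsteinV x y : card_le x y -> card_le y x -> card_eq x y.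
Proof.
move=> [f [fy fi]] [g [gx gi]].
(* [C] is the least class containing the points of [x] outside the image of [y] under [g] and closed
   under [g \o f]. The bijection is [f] on [C] and the inverse of [g] off it. *)
pose C z := forall P : V -> Prop,
  (forall u, u ∈ x -> (forall v, v ∈ y -> g v <> u) -> P u) ->
  (forall u, u ∈ x -> P u -> P (g (f u))) -> P z.
have C0 u : u ∈ x -> (forall v, v ∈ y -> g v <> u) -> C u by move=> ux H P P0 PS; apply: P0.
have CS u : u ∈ x -> C u -> C (g (f u)) by move=> ux Cu P P0 PS; apply: (PS u) => //; apply: Cu.
have CE v : v ∈ y -> C (g v) -> exists2 u, u ∈ x /\ C u & f u = v.
  move=> vy Cv; suff : C (g v) /\ forall v', v' ∈ y -> g v = g v' ->
      exists2 u, u ∈ x /\ C u & f u = v' by case=> _; apply.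
  apply: (Cv (fun z => C z /\ forall v', v' ∈ y -> z = g v' ->
      exists2 u, u ∈ x /\ C u & f u = v')).
    by move=> u ux H; split=> [|v' v'y E]; [apply: C0 | case: (H v')].
  move=> u ux [Cu _]; split=> [|v' v'y /gi E]; first exact: CS.
  by exists u => //; apply: E => //; apply: fy.
have inv z : z ∈ x -> ~ C z -> exists2 v, v ∈ y & g v = z.
  move=> zx nC; apply: contrapT => H; apply: nC; apply: C0 => // v vy E.
  by apply: H; exists v.
have [|h Hh] := @V_choice (memV^~ x) (fun z v => v ∈ y /\ ((C z /\ v = f z) \/ (~ C z /\ g v = z))).
  move=> z zx; have [Cz|nC] := pselect (C z); first by exists (f z); auto.
  by have [v] := inv z zx nC; exists v; auto.
exists h; split=> [u /Hh[]//|u v ux vx E|v vy].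
  have [uy [[Cu Eu]|[Cu Eu]]] := Hh u ux; have [vy [[Cv Ev]|[Cv Ev]]] := Hh v vx.
  - by apply: fi => //; rewrite -Eu -Ev.
  - by case: Cv; rewrite -Ev -E Eu; apply: CS.
  - by case: Cu; rewrite -Eu E Ev; apply: CS.
  - by rewrite -Eu -Ev E.
have [/(CE v vy)[u [ux Cu] E]|nC] := pselect (C (g v)).
  exists u => //; have [_ [[_ ->]//|[//]]] := Hh u ux.
exists (g v); first exact: gx.
have [hy [[//]|[_ E]]] := Hh (g v) (gx v vy).
by apply: gi.
Qed.

Section Hereditary.
Context (k : V) (hk : regular_uncountable k).

(** Cardinality at most [k], phrased by a covering map rather than an injection, which is convenient
    for images and unions. *)
Definition dominated (x : V) : Prop :=
  exists g : V -> V, forall u, u ∈ x -> exists2 v, v ∈ k & g v = u.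

Lemma dominated_card_le x : dominated x -> card_le x k.
Proof.
move=> [g Hg]; have [|f Hf] := @V_choice (memV^~ x) (fun u v => v ∈ k /\ g v = u).
  by move=> u /Hg[v vk E]; exists v.
by exists f; split=> [u /Hf[]//|u v /Hf[_ Eu] /Hf[_ Ev] E]; rewrite -Eu -Ev E.
Qed.

Lemma dominated_sub x y : x ⊆ y -> dominated y -> dominated x.
Proof. by move=> xy [g Hg]; exists g => u /xy/Hg. Qed.

(** The pairing [codeV] turns a covering by pairs from [k] into a covering by [k]. *)
Lemma dominated_image2 x (G : V -> V -> V) :
  (forall u, u ∈ x -> exists a b, [/\ a ∈ k, b ∈ k & G a b = u]) -> dominated x.
Proof.
move=> H; have [|d Hd] := @V_choice (memV^~ k) (fun c u => forall a b, a ∈ k -> b ∈ k ->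
    c = codeV a b -> u = G a b).
  move=> c ck; have [[a [b [ak bk E]]]|n] := pselect (exists a b, [/\ a ∈ k, b ∈ k & c = codeV a b]).
    by exists (G a b) => a' b' ak' bk'; rewrite E => /(codeV_inj hk)[] // -> ->.
  by exists ∅ => a b ak bk E; case: n; exists a, b.
exists d => u /H[a [b [ak bk E]]]; exists (codeV a b); first exact: codeV_regular.
by rewrite (Hd _ _ a b) //; apply: codeV_regular.
Qed.

Lemma dominated_union x y : dominated x -> dominated y -> dominated (union x y).
Proof.
move=> [f Hf] [g Hg].
apply: (@dominated_image2 _ (fun a b => if `[< a = ∅ >] then f b else g b)) => u.
have k0 := nat_V_regular hk 0; have k1 := nat_V_regular hk 1.
move=> /mem_union[/Hf|/Hg] [v vk E].
  by exists ∅, v; split=> //; case: asboolP.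
by exists (nat_V 1), v; split=> //; case: asboolP => // /(@nat_V_inj 1 0).
Qed.

Lemma dominated_bigunion x : dominated x -> (forall y, y ∈ x -> dominated y) ->
  dominated (bigunion x).
Proof.
move=> [f Hf] H.
have [|g Hg] := @choice V (V -> V)
    (fun y g => y ∈ x -> forall u, u ∈ y -> exists2 v, v ∈ k & g v = u).
  move=> y; have [/H[g Hg]|nx] := pselect (y ∈ x); first by exists g.
  by exists id.
apply: (@dominated_image2 _ (fun a b => g (f a) b)) => u /mem_bigunion[y yx uy].
have [a ak E] := Hf y yx; have [b bk E'] := Hg y yx u uy.
by exists a, b; rewrite E E'.
Qed.

(** An inductive form of membership in [H_{k^+}]: sizes are checked one level at a time, without
    computing transitive closures. *)
Inductive hereditary (x : V) : Prop :=
  Hereditary of dominated x & (forall y, y ∈ x -> hereditary y).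

Lemma dominated_upair x y : dominated (upair x y).
Proof.
exists (fun v => if `[< v = ∅ >] then x else y) => u /mem_upair[] ->.
  by exists ∅; [apply: nat_V_regular 0 | case: asboolP].
exists (nat_V 1); first exact: nat_V_regular 1.
by case: asboolP => // /(@nat_V_inj 1 0).
Qed.

Lemma hereditary_transitive x : hereditary x ->
  exists U, [/\ transitive_set U, x ∈ U & dominated U].
Proof.
elim=> {}x dx _ IH.
have [|U HU] := @V_choice (memV^~ x) (fun y U => [/\ transitive_set U, y ∈ U & dominated U]).
  exact: IH.
exists (union (upair x x) (bigunion (repl x U))); split.
- move=> y /mem_union[/mem_upair E|/mem_bigunion[_ /mem_repl[u ux ->] yU]] z zy; apply/mem_union; right.
    have {}zy : z ∈ x by case: E zy => ->.
    by apply/mem_bigunion; exists (U z); [apply/mem_repl; exists z | case: (HU z zy)].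
  apply/mem_bigunion; exists (U u); first by apply/mem_repl; exists u.
  by have [t _ _] := HU u ux; apply: t zy.
- by apply/mem_union; left; apply/mem_upair; left.
- apply: dominated_union; first exact: dominated_upair.
  apply: dominated_bigunion; last by move=> _ /mem_repl[u /HU[_ _ ?] ->].
  case: dx => g Hg; exists (U \o g) => _ /mem_repl[u /Hg[v vk <-] ->].
  by exists v.
Qed.

(** The transitive closure, cut out of a dominated transitive set, embeds into [k]. A bijection of
    it with [m] would embed [m] into [k], and Cantor-Bernstein would then equate [k] and [m]. *)
Lemma Hset_hereditary m x : succ_cardinal k m -> hereditary x -> Hset m x.
Proof.
move=> [_ [[f [fm fi]] nkm] _] /hereditary_transitive[U [tU xU dU]].
exists (sep U (fun z => forall t, transitive_set t -> x ⊆ t -> z ∈ t)).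
  split=> [y /mem_sep[yU Hy] z zy|y yx|t tt xt z /mem_sep[_]]; last by apply.
    apply/mem_sep; split; first exact: tU zy.
    by move=> t tt xt; apply: (tt y) => //; apply: Hy.
  by apply/mem_sep; split=> [|t _]; [apply: tU yx | apply].
set t := sep U _; have [g [gk gi]] : card_le t k.
  by apply: dominated_card_le; apply: dominated_sub dU => z /mem_sep[].
split.
  exists (f \o g); split=> [u ut|u v ut vt /= E]; first exact/fm/gk.
  by apply: gi => //; apply: fi => //; apply: gk.
move=> [h [ht hi hs]]; apply: nkm; apply: Cantor_BernsteinV; first by exists f.
have [|h' Hh'] := @V_choice (memV^~ m) (fun v u => u ∈ t /\ h u = v).
  by move=> v /hs[u ut E]; exists u.
exists (g \o h'); split=> [u /Hh'[ut _]|u v um vm /= E]; first exact: gk.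
have [ut Eu] := Hh' u um; have [vt Ev] := Hh' v vm.
by rewrite -Eu -Ev (gi _ _ ut vt E).
Qed.

Lemma hereditary_mem x : x ∈ k -> hereditary x.
Proof.
elim/V_ind: x => x IH xk; constructor.
  by exists id => u ux; exists u => //; apply: regular_trans xk.
by move=> y yx; apply: IH => //; apply: regular_trans xk.
Qed.

Lemma hereditary_upair x y : hereditary x -> hereditary y -> hereditary (upair x y).
Proof. by constructor; [apply: dominated_upair | move=> z /mem_upair[] ->]. Qed.

Lemma hereditary_opair x y : hereditary x -> hereditary y -> hereditary (opair x y).
Proof. by move=> hx hy; do !apply: hereditary_upair. Qed.

Lemma hereditary_relV r : hereditary (relV k r).
Proof.
constructor.
  by apply: (@dominated_image2 _ pairV) => u /relV_pair[x [y [xk yk _ ->]]]; exists x, y.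
move=> _ /relV_pair[x [y [xk yk _ ->]]]; rewrite pairVE.
by apply: hereditary_upair; apply: hereditary_opair; apply: hereditary_mem => //;
  [apply: nat_V_regular 0 | apply: nat_V_regular 1].
Qed.

Lemma hereditary_seq_V A : (forall n, hereditary (A n)) -> hereditary (seq_V A).
Proof.
move=> HA; constructor.
  have [f Hf] := nat_V_extend (fun n => opair (nat_V n) (A n)).
  exists f => u /mem_mkV[n ->]; exists (nat_V n) => //; exact: nat_V_regular.
move=> _ /mem_mkV[n ->]; apply: hereditary_opair; last exact: HA.
by apply: hereditary_mem; apply: nat_V_regular.
Qed.

End Hereditary.

(** * The sentence *)

Implicit Types (rho : nat -> V -> V -> Prop) (P : V -> Prop).

(* The formula [triple a rho P1 P2 P3] says that the subsets [P1], [P2], [P3] of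
   [a] code functions forming a triple of a closed set: [rho 0 x e] reads "e
   codes a pair with first component x", and [rho 4 i i] reads "i names a box
   disjoint from the closed set", whose three sides are [rho 1 i], [rho 2 i],
   [rho 3 i]. *)
Definition total (a : V) rho P : Prop :=
  forall x, x ∈ a -> exists2 e, e ∈ a & rho 0 x e /\ P e.

Definition inside (a : V) rho (n : nat) (i : V) P : Prop :=
  forall e, e ∈ a -> rho n i e -> P e.

Definition triple (a : V) rho P1 P2 P3 : Prop :=
  (total a rho P1 /\ (total a rho P2 /\ total a rho P3)) /\
  forall i, i ∈ a -> rho 4 i i ->
    ~ (inside a rho 1 i P1 /\ (inside a rho 2 i P2 /\ inside a rho 3 i P3)).

(** Only the symbols 0 to 4 and arguments in [a] are read, so predicates may be replaced by their
    restrictions to [a]. *)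
Lemma triple_ext a rho rho' P1 P2 P3 P1' P2' P3' :
  (forall n x y, n < 5 -> x ∈ a -> y ∈ a -> rho n x y <-> rho' n x y) ->
  (forall e, e ∈ a -> P1 e <-> P1' e) ->
  (forall e, e ∈ a -> P2 e <-> P2' e) ->
  (forall e, e ∈ a -> P3 e <-> P3' e) ->
  triple a rho P1 P2 P3 -> triple a rho' P1' P2' P3'.
Proof.
move=> Er E1 E2 E3.
have tot P P' : (forall e, e ∈ a -> P e <-> P' e) -> total a rho P -> total a rho' P'.
  by move=> E H x xa; have [e ea [/Er re /E Pe]] := H x xa; exists e => //; split; auto.
have ins n i P P' : n < 5 -> i ∈ a -> (forall e, e ∈ a -> P e <-> P' e) ->
    inside a rho' n i P' -> inside a rho n i P.
  by move=> n5 ia E H e ea re; apply/E/H => //; apply/Er.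
move=> [[T1 [T2 T3]] B]; split.
  by split; [apply: tot T1 | split; [apply: tot T2 | apply: tot T3]].
move=> i ia /Er ri [I1 [I2 I3]]; apply: (B i ia (ri _ _ _)) => //.
by split; [apply: ins I1 | split; [apply: ins I2 | apply: ins I3]].
Qed.

(** Binary symbols suffice: unary predicates are read on the diagonal, and sets are fibres of
    relations. *)
Definition L2 : language := Language 2 2 (fun _ => 2).

Definition fA (n i j : nat) : formula L2 := @PredA L2 n [tuple i; j].
Definition fX (i j : nat) : formula L2 := @PredX L2 [tuple i; j].
Definition fY (i j : nat) : formula L2 := @PredY L2 [tuple i; j].

(** Variables 10 and 11 are bound inside [ftriple], while 0 to 4 hold fibre tags and 5 an index [b];
    hence no capture occurs. *)
Definition ftotal (f : nat -> formula L2) : formula L2 :=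
  All 10 (Ex 11 (And (fA 0 10 11) (f 11))).
Definition finside (n : nat) (f : nat -> formula L2) : formula L2 :=
  All 11 (Imp (fA n 10 11) (f 11)).
Definition ftriple (f1 f2 f3 : nat -> formula L2) : formula L2 :=
  And (And (ftotal f1) (And (ftotal f2) (ftotal f3)))
    (All 10 (Imp (fA 4 10 10)
      (Not (And (finside 1 f1) (And (finside 2 f2) (finside 3 f3)))))).

(** Symbols 7 to 11 force the variables 0 to 4 to be those numerals. Fibres 0, 1, 2 of [X] code
    three functions, fibres 3 and 4 the witnesses relating consecutive ones, and fibre 0 of [Y] the
    witness relating the first to the last. *)
Definition ftrans : formula L2 :=
  All 0 (All 1 (All 2 (All 3 (All 4
    (Imp (fA 7 0 0) (Imp (fA 8 1 1) (Imp (fA 9 2 2) (Imp (fA 10 3 3) (Imp (fA 11 4 4)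
      (Imp (ftriple (fX 0) (fX 1) (fX 3)) (Imp (ftriple (fX 1) (fX 2) (fX 4))
        (ftriple (fX 0) (fX 2) (fY 0))))))))))))).

(** Fibre 0 of [X] is a candidate witness for the [b]-th pair given by symbols 5 and 6. As [X] is
    quantified universally, no witness exists for any [b]. *)
Definition funrelated : formula L2 :=
  All 0 (Imp (fA 7 0 0) (All 5 (Not (ftriple (fA 5 5) (fA 6 5) (fX 0))))).

Lemma closed_matrix : free_vars (And ftrans funrelated) = [::].
Proof. by []. Qed.

Definition phi : pi12 := Pi12 closed_matrix.

Definition fiber (X : V) (t : nat) (e : V) : Prop := pairV (nat_V t) e ∈ X.

Definition trans_at (a : V) rho (X Y : V) : Prop :=
  triple a rho (fiber X 0) (fiber X 1) (fiber X 3) ->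
  triple a rho (fiber X 1) (fiber X 2) (fiber X 4) ->
  triple a rho (fiber X 0) (fiber X 2) (fiber Y 0).

Definition unrelated_at (a : V) rho (X : V) : Prop :=
  forall b, b ∈ a -> ~ triple a rho (rho 5 b) (rho 6 b) (fiber X 0).

Lemma sat_phi a rho X Y : (forall t, nat_V t ∈ a) ->
  (forall t s, rho (7 + t) s s <-> s = nat_V t) ->
  sat a X Y (fun n => relV a (rho n)) (fun _ => ∅) (matrix phi) <->
  trans_at a rho X Y /\ unrelated_at a rho X.
Proof.
move=> ta Htag.
have relE n x y : n < 5 -> x ∈ a -> y ∈ a -> pairV x y ∈ relV a (rho n) <-> rho n x y.
  by move=> _ xa ya; rewrite mem_relV; split=> [[]|].
have relE' n x y : n < 5 -> x ∈ a -> y ∈ a -> rho n x y <-> pairV x y ∈ relV a (rho n).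
  by move=> n5 xa ya; rewrite relE.
pose rho' n x y := pairV x y ∈ relV a (rho n).
have sat1 : sat a X Y (fun n => relV a (rho n)) (fun _ => ∅) ftrans <->
    forall s0, s0 ∈ a -> forall s1, s1 ∈ a -> forall s2, s2 ∈ a ->
    forall s3, s3 ∈ a -> forall s4, s4 ∈ a ->
    rho' 7 s0 s0 -> rho' 8 s1 s1 -> rho' 9 s2 s2 -> rho' 10 s3 s3 -> rho' 11 s4 s4 ->
    triple a rho' (fun e => pairV s0 e ∈ X) (fun e => pairV s1 e ∈ X) (fun e => pairV s3 e ∈ X) ->
    triple a rho' (fun e => pairV s1 e ∈ X) (fun e => pairV s2 e ∈ X) (fun e => pairV s4 e ∈ X) ->
    triple a rho' (fun e => pairV s0 e ∈ X) (fun e => pairV s2 e ∈ X) (fun e => pairV s0 e ∈ Y).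
  (* Satisfaction computes: variables are concrete numerals, and the tuple of two values is [pairV]
     by unfolding. *)
  exact: iff_refl.
have sat2 : sat a X Y (fun n => relV a (rho n)) (fun _ => ∅) funrelated <->
    forall s0, s0 ∈ a -> rho' 7 s0 s0 -> forall b, b ∈ a ->
    ~ triple a rho' (rho' 5 b) (rho' 6 b) (fun e => pairV s0 e ∈ X).
  exact: iff_refl.
have conv P1 P2 P3 : triple a rho P1 P2 P3 <-> triple a rho' P1 P2 P3.
  by split; apply: triple_ext => // n x y n5 xa ya; rewrite /rho' relE.
have tag t : rho' (7 + t) (nat_V t) (nat_V t) by apply/mem_relV; split=> //; apply/Htag.
have tag' t s : rho' (7 + t) s s -> s = nat_V t by move=> /mem_relV[_ _ /Htag].
split.
  move=> [/sat1 H1 /sat2 H2]; split=> [T1 T2|b ba T].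
    apply/conv/(H1 _ (ta 0) _ (ta 1) _ (ta 2) _ (ta 3) _ (ta 4)
      (tag 0) (tag 1) (tag 2) (tag 3) (tag 4)); exact/conv.
  apply: (H2 _ (ta 0) (tag 0) b ba); apply: (triple_ext relE' _ _ _ T) => // e ea.
    by rewrite /rho' mem_relV; split=> [|[]].
  by rewrite /rho' mem_relV; split=> [|[]].
move=> [H1 H2]; split.
  apply/sat1 => s0 _ s1 _ s2 _ s3 _ s4 _.
  move=> /(@tag' 0)-> /(@tag' 1)-> /(@tag' 2)-> /(@tag' 3)-> /(@tag' 4)-> T1 T2.
  by apply/conv/H1; apply/conv.
apply/sat2 => s0 _ /(@tag' 0)-> b ba T; apply: (H2 b ba).
apply: (triple_ext relE _ _ _ T) => // e ea; rewrite /rho' mem_relV; by split=> [[]|].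
Qed.

Lemma models_in_phi (M : V -> Prop) a rho : (forall t, nat_V t ∈ a) ->
  (forall t s, rho (7 + t) s s <-> s = nat_V t) ->
  models_in M a (fun n => relV a (rho n)) phi <->
  M (seq_V (fun n => relV a (rho n))) /\
  forall X, M X -> rel_on 2 a X ->
    exists Y, [/\ M Y, rel_on 2 a Y, trans_at a rho X Y & unrelated_at a rho X].
Proof.
move=> ta Htag; split=> -[HM H]; split=> // X MX Xa.
  have [Y [MY Ya /(sat_phi _ _ ta Htag)[]]] := H X MX Xa.
  by exists Y.
have [Y [MY Ya T U]] := H X MX Xa.
by exists Y; split=> //; apply/(sat_phi _ _ ta Htag).
Qed.

(** * Coding functions and closed sets *)

Section Coding.
Context (k : V) (hk : regular_uncountable k).

Lemma decode_exists : exists d : V -> V, (forall e, e ∈ k -> d e ∈ k) /\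
  forall x y, x ∈ k -> y ∈ k -> d (codeV x y) = x.
Proof.
have [|d Hd] := @V_choice (memV^~ k) (fun e x => x ∈ k /\
    forall x' y, x' ∈ k -> y ∈ k -> e = codeV x' y -> x = x').
  move=> e ek; have [[x [y [xk yk E]]]|n] :=
      pselect (exists x y, [/\ x ∈ k, y ∈ k & e = codeV x y]).
    by exists x; split=> // x' y' xk' yk'; rewrite E => /(codeV_inj hk)[].
  exists ∅; split; first exact: (nat_V_regular hk 0).
  by move=> x y xk yk E; case: n; exists x, y.
exists d; split=> [e /Hd[]//|x y xk yk].
have ck : codeV x y ∈ k by apply: codeV_regular.
by have [_ H] := Hd _ ck; apply: H erefl.
Qed.

(* The code of [eta] is cut down to [a] in a way that depends on [eta] only
   below [a]. *)
Definition coded (a eta : V) : V :=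
  sep a (fun e => exists2 x, x ∈ a & e = codeV x (app eta x)).

Lemma mem_coded a eta e :
  e ∈ coded a eta <-> e ∈ a /\ exists2 x, x ∈ a & e = codeV x (app eta x).
Proof. exact: mem_sep. Qed.

Lemma coded_mem eta x : baire k eta -> x ∈ k -> codeV x (app eta x) ∈ coded k eta.
Proof.
move=> He xk; apply/mem_coded; split; last by exists x.
by apply: codeV_regular => //; have [] := is_fun_app He xk.
Qed.

Lemma coded_fun eta x y : baire k eta -> x ∈ k -> y ∈ k ->
  codeV x y ∈ coded k eta -> y = app eta x.
Proof.
move=> He xk yk /mem_coded[_ [x' xk' E]].
by have [|-> ->] := codeV_inj hk xk yk xk' _ E; first by have [] := is_fun_app He xk'.
Qed.

Lemma coded_inj eta xi : baire k eta -> baire k xi -> coded k eta ⊆ coded k xi -> eta = xi.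
Proof.
move=> He Hx sub; apply: (is_fun_ext He Hx) => x xk.
apply: (coded_fun Hx xk); first by have [] := is_fun_app He xk.
exact/sub/coded_mem.
Qed.

(** At closure points of the decoding map, a code below [a] has its argument below [a], which gives
    the inclusion from right to left. *)
Lemma clubly_coded_restr eta : baire k eta ->
  clubly k (fun a => coded a eta = inter (coded k eta) a).
Proof.
move=> He; have [d [dk Hd]] := decode_exists.
apply: (clublyW (clubly_unary dk)) => a ak _ ca; apply: V_ext => e.
rewrite mem_inter !mem_coded; split=> [[ea [x xa E]]|[[ek [x xk E]] ea]].
  split=> //; split; first exact: regular_trans ak.
  by exists x => //; apply: regular_trans ak.
split=> //; exists x => //; have := ca e ea.
by rewrite E Hd //; have [] := is_fun_app He xk.
Qed.

Lemma clubly_codeV_closed eta : baire k eta ->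
  clubly k (fun a => forall x, x ∈ a -> codeV x (app eta x) ∈ a).
Proof.
move=> He; apply: clubly_unary => x xk; apply: codeV_regular => //.
by have [] := is_fun_app He xk.
Qed.

(** A cone prescribes values only on some [d ∈ k]; their codes are bounded by regularity, and
    containing them puts a function in the cone. *)
Lemma bounded_coded z eta : bounded_fun k z -> baire k eta -> z ⊆ eta ->
  exists b, [/\ exists2 m, m ∈ k & b ⊆ m, b ⊆ coded k eta &
    forall eta', baire k eta' -> b ⊆ coded k eta' -> z ⊆ eta'].
Proof.
move=> [d dk Hz] He ze.
have inE x : x ∈ d -> codeV x (app eta x) ∈ coded k eta.
  by move=> xd; apply: coded_mem => //; apply: regular_trans dk.
exists (repl d (fun x => codeV x (app eta x))); split.
- exists (bigunion (repl d (fun x => succV (codeV x (app eta x))))).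
    apply: bigunion_regular => // x /inE /mem_coded[ck _]; exact: succV_regular.
  move=> _ /mem_repl[x xd ->]; apply/mem_bigunion.
  exists (succV (codeV x (app eta x))); last exact: mem_succV_self.
  by apply/mem_repl; exists x.
- by move=> _ /mem_repl[x /inE H ->].
- move=> eta' He' sub p pz; have [x [y [xd yk E]]] := Hz.1 _ pz.
  rewrite E in pz *; have xk : x ∈ k by apply: regular_trans dk.
  have [_ yk' <-] := is_fun_appE He (ze _ pz).
  have cc : codeV x (app eta x) ∈ coded k eta' by apply: sub; apply/mem_repl; exists x.
  rewrite (coded_fun He' xk _ cc); first by have [] := is_fun_app He' xk.
  by have [] := is_fun_app He xk.
Qed.

(** Pairwise consistency is enough: totality yields [f], and any [e] in [P] with argument [x] shares
    a function with the code of [(x, f x)], hence equals that code. *)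
Lemma coded_of_total P :
  (forall x, x ∈ k -> exists2 e, e ∈ k & (exists2 y, y ∈ k & e = codeV x y) /\ P e) ->
  (forall e e', e ∈ k -> e' ∈ k -> P e -> P e' ->
     exists eta, [/\ baire k eta, e ∈ coded k eta & e' ∈ coded k eta]) ->
  exists2 eta, baire k eta & forall e, e ∈ k -> P e <-> e ∈ coded k eta.
Proof.
move=> T C.
have [|f Hf] := @V_choice (memV^~ k) (fun x y => y ∈ k /\ P (codeV x y)).
  by move=> x /T[e ek [[y yk ->] Pe]]; exists y.
have Hg : baire k (graph k f) by apply: graph_fun => x /Hf[].
exists (graph k f) => // e ek; split=> [Pe|/mem_coded[_ [x xk ->]]]; last first.
  by rewrite app_graph //; case: (Hf x xk).
have [eta [He /mem_coded[_ [x xk E]] _]] := C e e ek ek Pe Pe.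
have [fk Pf] := Hf x xk.
have [xi [Hx /mem_coded[_ [x1 xk1 E1]] c2]] := C e _ ek (codeV_regular hk xk fk) Pe Pf.
have E2 := coded_fun Hx xk fk c2.
have [||Ex1 _] := codeV_inj hk xk _ xk1 _ (etrans (esym E) E1).
- by have [] := is_fun_app He xk.
- by have [] := is_fun_app Hx xk1.
by apply/mem_coded; split=> //; exists x => //; rewrite app_graph // E1 -Ex1 E2.
Qed.

End Coding.

(** * Names for bounded boxes, and the meaning of [triple] on [k] and on its closure points *)

Section Reduction.
Context (k S : V) (hk : regular_uncountable k) (hS : stationary k S).
Context (N : V -> V) (hN : forall a, a ∈ S -> card_lt (N a) k /\ sees (N a) a).
Context (hguess : forall X, X ⊆ k -> exists2 C, club k C &
  forall a, a ∈ C -> a ∈ S -> inter X a ∈ N a).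
Context (F : V -> V -> V -> Prop) (hF : closed3 k F).
(* Makes all elements of the [N a], [a ∈ S], nameable by (codes of) pairs of
   elements of [k]. *)
Context (name : V -> V -> V)
  (hname : forall a, a ∈ S -> (forall u, u ∈ N a -> name a u ∈ k) /\ inj_on (N a) (name a)).

Let Sk a : a ∈ S -> a ∈ k. Proof. by case: hS => sub _; apply: sub. Qed.

Lemma sees_self a : a ∈ S -> a ∈ N a.
Proof. by move=> /hN[_ [_ _]]; apply; apply/mem_adjoin; right. Qed.

Lemma sees_mem a b : a ∈ S -> b ∈ a -> b ∈ N a.
Proof. by move=> /hN[_ [_ _ H]] ba; apply: H; apply/mem_adjoin; left. Qed.

Lemma sees_trans a : a ∈ S -> transitive_set (N a).
Proof. by move=> /hN[_ []]. Qed.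

Lemma sees_pr a : a ∈ S -> pr_closed (N a).
Proof. by move=> /hN[_ []]. Qed.

Lemma clubly_guess X : X ⊆ k -> clubly k (fun a => a ∈ S -> inter X a ∈ N a).
Proof.
move=> /hguess[C cC HC]; apply: (clublyW (clubly_club hk cC)) => a _ _; exact: HC.
Qed.

Lemma clubly_nat : clubly k (fun a => forall t, nat_V t ∈ a).
Proof.
have ok : omega ∈ k by case: hk.
apply: (clublyW (clubly_above hk ok)) => a ak _ oa t.
by apply: (ordinal_trans (mem_regular_ordinal hk ak) _ oa); apply/mem_omega; exists t.
Qed.

(** A set may have several names, one for each [a] with [J ∈ N a], but a name determines its set. *)
Definition named (i J : V) : Prop :=
  exists2 a, a ∈ S & J ∈ N a /\ i = codeV a (name a J).

Lemma named_inj i J J' : named i J -> named i J' -> J = J'.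
Proof.
move=> [a aS [Ja ->]] [b bS [Jb E]].
have [na ia] := hname aS; have [nb _] := hname bS.
have [] := codeV_inj hk (Sk aS) (na _ Ja) (Sk bS) (nb _ Jb) E.
by move=> Eab; rewrite -Eab in Jb *; apply: ia.
Qed.

(** The sides are the fibres 0, 1, 2 of [J]. The bound [m] allows closure points above a name to
    contain all sides of its box. *)
Definition missed_box (i : V) : Prop :=
  exists J, [/\ named i J, exists2 m, m ∈ k & forall t e, fiber J t e -> e ∈ m &
    ~ exists eta xi zeta, [/\ F eta xi zeta,
        forall e, fiber J 0 e -> e ∈ coded k eta,
        forall e, fiber J 1 e -> e ∈ coded k xi &
        forall e, fiber J 2 e -> e ∈ coded k zeta]].

(** Symbols 5 and 6 stay parameters, to be filled by the families of counterexamples; from 7 on come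
    the numerals. *)
Definition rhoF (H0 H1 : V -> V -> Prop) (n : nat) : V -> V -> Prop :=
  match n with
  | 0 => fun x e => exists2 y, y ∈ k & e = codeV x y
  | 1 => fun i e => exists2 J, named i J & fiber J 0 e
  | 2 => fun i e => exists2 J, named i J & fiber J 1 e
  | 3 => fun i e => exists2 J, named i J & fiber J 2 e
  | 4 => fun i _ => missed_box i
  | 5 => H0
  | 6 => H1
  | t => fun s _ => s = nat_V (t - 7)
  end.

Lemma rhoF_tag H0 H1 t s : rhoF H0 H1 (7 + t) s s <-> s = nat_V t.
Proof. by rewrite /rhoF -[t in X in _ <-> X](addKn 7) !addnE /=. Qed.

Definition boxed P (b : V) : Prop :=
  (exists2 m, m ∈ k & b ⊆ m) /\ forall e, e ∈ b -> P e.

(** Some [N a] contains the three bounded sets, hence also the relation packing them, so their box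
    has a name. If it missed [F], that name would violate the last clause of [triple]. *)
Lemma triple_boxed H0 H1 P1 P2 P3 b1 b2 b3 : triple k (rhoF H0 H1) P1 P2 P3 ->
  boxed P1 b1 -> boxed P2 b2 -> boxed P3 b3 ->
  exists eta xi zeta, [/\ F eta xi zeta, b1 ⊆ coded k eta, b2 ⊆ coded k xi & b3 ⊆ coded k zeta].
Proof.
move=> [_ B] [[m1 mk1 bm1] HP1] [[m2 mk2 bm2] HP2] [[m3 mk3 bm3] HP3].
have cl m b : m ∈ k -> b ⊆ m -> clubly k (fun a => m ∈ a /\ (a ∈ S -> inter b a ∈ N a)).
  move=> mk bm; apply: clublyI => //; first exact: clubly_above.
  by apply: clubly_guess => e /bm em; apply: regular_trans mk.
have [a aS [[[ma1 g1] [[ma2 g2] [ma3 g3]]] ta]] := stationary_clubly hk hS (clublyI hk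
  (clublyI hk (cl _ _ mk1 bm1) (clublyI hk (cl _ _ mk2 bm2) (cl _ _ mk3 bm3))) clubly_nat).
have oa := mem_regular_ordinal hk (Sk aS).
have sub m b : m ∈ a -> b ⊆ m -> b ⊆ a by move=> ma bm e /bm em; apply: ordinal_trans em ma.
have intE m b : m ∈ a -> b ⊆ m -> inter b a = b.
  move=> ma bm; apply: V_ext => e; rewrite mem_inter; split=> [[]//|eb].
  by split=> //; apply: sub ma bm e eb.
have ba1 := sub _ _ ma1 bm1; have ba2 := sub _ _ ma2 bm2; have ba3 := sub _ _ ma3 bm3.
move: (g1 aS) (g2 aS) (g3 aS).
rewrite (intE _ _ ma1 bm1) (intE _ _ ma2 bm2) (intE _ _ ma3 bm3) => bN1 bN2 bN3.
pose J := slices a [:: b1; b2; b3].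
have JN : J ∈ N a.
  apply: pr_closed_slices; [exact: sees_pr|exact: sees_trans|exact: sees_self|].
  by move=> [|[|[|t]]] //=; rewrite nth_nil; apply: pr_closed0; apply: sees_pr.
have fibJ t e : fiber J t e <-> e ∈ nth ∅ [:: b1; b2; b3] t.
  split=> [/mem_relV[_ _ [t' /nat_V_inj-> //]]|H]; apply/mem_slices => //.
  by move: t H => [/ba1|[/ba2|[/ba3|t]]] //=; rewrite nth_nil => /mem_empty.
have [nk ni] := hname aS.
have nJ : named (codeV a (name a J)) J by exists a.
apply: contrapT => nF.
apply: (B (codeV a (name a J))).
- by apply: codeV_regular => //; [apply: Sk | apply: nk].
- exists J; split=> //.
    by exists a; [apply: Sk | move=> t e /mem_relV[]].
  move=> [eta [xi [zeta [HF E1 E2 E3]]]]; apply: nF; exists eta, xi, zeta; split=> // e eb.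
  + by apply: E1; apply/fibJ.
  + by apply: E2; apply/fibJ.
  + by apply: E3; apply/fibJ.
- split; last split; move=> e ek [J' nJ' fJ']; rewrite -(named_inj nJ nJ') in fJ'.
  + by apply: HP1; apply/(fibJ 0).
  + by apply: HP2; apply/(fibJ 1).
  + by apply: HP3; apply/(fibJ 2).
Qed.

Lemma boxed_empty P : boxed P ∅.
Proof.
split; last by move=> e /mem_empty.
by exists ∅; [exact: (nat_V_regular hk 0) | move=> e /mem_empty].
Qed.

Lemma boxed_upair P e e' : e ∈ k -> e' ∈ k -> P e -> P e' -> boxed P (upair e e').
Proof.
move=> ek ek' Pe Pe'; split; last by move=> u /mem_upair[] ->.
exists (union (succV e) (succV e')); first by apply: union_regular => //; apply: succV_regular.
by move=> u /mem_upair[] ->; apply/mem_union; [left|right]; apply: mem_succV_self.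
Qed.

(** Boxes with two codes on one side make each predicate the code of a function. Were the resulting
    triple outside [F], closedness would give a basic box around it missing [F], against
    [triple_boxed]. *)
Lemma triple_decode H0 H1 P1 P2 P3 : triple k (rhoF H0 H1) P1 P2 P3 ->
  exists eta xi zeta, [/\ F eta xi zeta, forall e, e ∈ k -> P1 e <-> e ∈ coded k eta,
    forall e, e ∈ k -> P2 e <-> e ∈ coded k xi & forall e, e ∈ k -> P3 e <-> e ∈ coded k zeta].
Proof.
move=> T; have [[T1 [T2 T3]] _] := T.
have in1 e e' : e ∈ upair e e' by apply/mem_upair; left.
have in2 e e' : e' ∈ upair e e' by apply/mem_upair; right.
have [eta He E1] : exists2 eta, baire k eta & forall e, e ∈ k -> P1 e <-> e ∈ coded k eta.
  apply: coded_of_total T1 _ => // e e' ek ek' Pe Pe'.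
  have [eta [xi [zeta [/(hF.1)[He _ _] H _ _]]]] :=
    triple_boxed T (boxed_upair ek ek' Pe Pe') (boxed_empty _) (boxed_empty _).
  by exists eta; split=> //; apply: H.
have [xi Hx E2] : exists2 eta, baire k eta & forall e, e ∈ k -> P2 e <-> e ∈ coded k eta.
  apply: coded_of_total T2 _ => // e e' ek ek' Pe Pe'.
  have [eta' [xi [zeta [/(hF.1)[_ Hx _] _ H _]]]] :=
    triple_boxed T (boxed_empty _) (boxed_upair ek ek' Pe Pe') (boxed_empty _).
  by exists xi; split=> //; apply: H.
have [zeta Hz E3] : exists2 eta, baire k eta & forall e, e ∈ k -> P3 e <-> e ∈ coded k eta.
  apply: coded_of_total T3 _ => // e e' ek ek' Pe Pe'.
  have [eta' [xi' [zeta [/(hF.1)[_ _ Hz] _ _ H]]]] :=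
    triple_boxed T (boxed_empty _) (boxed_empty _) (boxed_upair ek ek' Pe Pe').
  by exists zeta; split=> //; apply: H.
exists eta, xi, zeta; split=> //; apply: contrapT => nF.
have [a [b [c [[ba bb bc] [[_ ca] [_ cb] [_ cc]] Hopen]]]] :=
  hF.2.2 eta xi zeta (And4 He Hx Hz nF).
have [b1 [m1 s1 C1]] := bounded_coded hk ba He ca.
have [b2 [m2 s2 C2]] := bounded_coded hk bb Hx cb.
have [b3 [m3 s3 C3]] := bounded_coded hk bc Hz cc.
have codedk u e : e ∈ coded k u -> e ∈ k by move=> /mem_coded[].
have [eta' [xi' [zeta' [HF i1 i2 i3]]]] : exists eta xi zeta, [/\ F eta xi zeta,
    b1 ⊆ coded k eta, b2 ⊆ coded k xi & b3 ⊆ coded k zeta].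
  apply: (triple_boxed T); split=> // e.
  - by move=> /s1 ec; apply/E1 => //; apply: codedk ec.
  - by move=> /s2 ec; apply/E2 => //; apply: codedk ec.
  - by move=> /s3 ec; apply/E3 => //; apply: codedk ec.
have [He' Hx' Hz'] := hF.1 _ _ _ HF.
have [] := Hopen eta' xi' zeta' (conj He' (C1 _ He' i1)) (conj Hx' (C2 _ Hx' i2))
  (conj Hz' (C3 _ Hz' i3)).
by [].
Qed.

(** Codes cut down to [a] are parts of the full codes; since the sides of a missed box named below
    [a] lie in [a], their inclusion can be tested inside [a]. *)
Lemma triple_coded_gen H0 H1 a eta xi zeta : F eta xi zeta -> a ⊆ k ->
  (forall i J t e, i ∈ a -> missed_box i -> named i J -> fiber J t e -> e ∈ a) ->
  (forall x, x ∈ a -> codeV x (app eta x) ∈ a) ->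
  (forall x, x ∈ a -> codeV x (app xi x) ∈ a) ->
  (forall x, x ∈ a -> codeV x (app zeta x) ∈ a) ->
  triple a (rhoF H0 H1) (memV^~ (coded a eta)) (memV^~ (coded a xi)) (memV^~ (coded a zeta)).
Proof.
move=> HF ak bd ce cx cz; have [He Hx Hz] := hF.1 _ _ _ HF.
have tot u : baire k u -> (forall x, x ∈ a -> codeV x (app u x) ∈ a) ->
    total a (rhoF H0 H1) (memV^~ (coded a u)).
  move=> Hu cu x xa; exists (codeV x (app u x)); first exact: cu.
  split; first by exists (app u x) => //; have [] := is_fun_app Hu (ak _ xa).
  by apply/mem_coded; split; [apply: cu | exists x].
split; first by split; [apply: tot | split; apply: tot].
move=> i ia mi [I1 [I2 I3]]; have [J [nJ _ nF]] := mi.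
have up u e : e ∈ coded a u -> e ∈ coded k u.
  by move=> /mem_coded[ea [x xa E]]; apply/mem_coded; split; [apply: ak | exists x => //; apply: ak].
apply: nF; exists eta, xi, zeta; split=> // e fe; apply: up.
- by apply: I1; [apply: (bd _ _ _ _ ia mi nJ fe) | exists J].
- by apply: I2; [apply: (bd _ _ _ _ ia mi nJ fe) | exists J].
- by apply: I3; [apply: (bd _ _ _ _ ia mi nJ fe) | exists J].
Qed.

Lemma triple_coded H0 H1 eta xi zeta : F eta xi zeta ->
  triple k (rhoF H0 H1) (memV^~ (coded k eta)) (memV^~ (coded k xi)) (memV^~ (coded k zeta)).
Proof.
move=> HF; have [He Hx Hz] := hF.1 _ _ _ HF.
apply: (triple_coded_gen _ _ HF) => //.
- move=> i J t e ik [J' [nJ' [m mk Hm] _]] nJ fe; rewrite (named_inj nJ nJ') in fe.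
  by apply: regular_trans mk => //; apply: Hm fe.
- by move=> x /(coded_mem hk He)/mem_coded[].
- by move=> x /(coded_mem hk Hx)/mem_coded[].
- by move=> x /(coded_mem hk Hz)/mem_coded[].
Qed.

Lemma clubly_triple_coded H0 H1 eta xi zeta : F eta xi zeta ->
  clubly k (fun a => triple a (rhoF H0 H1)
    (memV^~ (coded a eta)) (memV^~ (coded a xi)) (memV^~ (coded a zeta))).
Proof.
move=> HF; have [He Hx Hz] := hF.1 _ _ _ HF.
(* [h i] bounds the sides of the missed box named by [i]; the value is immaterial when there is
   none. *)
have [|h Hh] := @V_choice (memV^~ k) (fun i m => m ∈ k /\
    forall J t e, missed_box i -> named i J -> fiber J t e -> e ∈ m).
  move=> i ik; have [[J [nJ [m mk Hm] _]]|n] := pselect (missed_box i).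
    by exists m; split=> // J' t e _ nJ'; rewrite (named_inj nJ' nJ); apply: Hm.
  by exists ∅; split=> //; exact: (nat_V_regular hk 0).
have hkk i : i ∈ k -> h i ∈ k by move=> /Hh[].
apply: (clublyW (clublyI hk (clubly_unary hkk) (clublyI hk (clubly_codeV_closed hk He)
  (clublyI hk (clubly_codeV_closed hk Hx) (clubly_codeV_closed hk Hz))))).
move=> a ak _ [ch [ce [cx cz]]]; apply: (triple_coded_gen _ _ HF) => //.
  by move=> x xa; apply: regular_trans ak.
move=> i J t e ia mi nJ fe; have [_ H] := Hh i (regular_trans hk ia ak).
exact: ordinal_trans (mem_regular_ordinal hk ak) (H J t e mi nJ fe) (ch i ia).
Qed.
End Reduction.

(** * The reduction *)

Section Marking.
Context (k S : V) (hk : regular_uncountable k) (hS : stationary k S).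
Context (N : V -> V) (hN : forall a, a ∈ S -> card_lt (N a) k /\ sees (N a) a).
Context (hguess : forall X, X ⊆ k -> exists2 C, club k C &
  forall a, a ∈ C -> a ∈ S -> inter X a ∈ N a).
Context (hreflect : forall (psi : pi12) (A : nat -> V),
  (forall n, rel_on (arA psi n) k (A n)) -> models k A psi ->
  stationary k (sep S (fun a => card_eq (N a) a /\
    models_in (fun x => x ∈ N a) a (fun n => sep (A n) (is_tuple (arA psi n) a)) psi))).
Context (F : V -> V -> V -> Prop) (hF : closed3 k F).
Context (name : V -> V -> V)
  (hname : forall a, a ∈ S -> (forall u, u ∈ N a -> name a u ∈ k) /\ inj_on (N a) (name a)).
Context (Q : V -> V -> Prop) (hQ : quasi_order (baire k) Q).
Context (hFQ : forall eta xi, Q eta xi <->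
  [/\ baire k eta, baire k xi & exists2 zeta, baire k zeta & F eta xi zeta]).
Context (en : V -> V -> V)
  (hen : forall a, a ∈ S -> card_eq (N a) a -> (forall b, b ∈ a -> en a b ∈ N a) /\
    forall u, u ∈ N a -> exists2 b, b ∈ a & en a b = u).

Notation rho := (rhoF k S N F name).
Notation rho0 := (rho (fun _ _ => False) (fun _ _ => False)).

Lemma F_Q eta xi zeta : F eta xi zeta -> Q eta xi.
Proof. by move=> HF; have [He Hx Hz] := hF.1 _ _ _ HF; apply/hFQ; split=> //; exists zeta. Qed.

(** The index [b] is used twice, in the enumeration and as the fibre taken: a family listed as the
    [b]-th element of [N a] is thus met at its own [b]-th member. *)
Definition guess (b a : V) : V := section a b (en a b).

Definition transitive_in (a : V) : Prop :=
  forall X, X ∈ N a -> rel_on 2 a X -> exists Y, [/\ Y ∈ N a, rel_on 2 a Y & trans_at a rho0 X Y].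

(** The equality disjunct replaces reflexivity, which the reflected sentence does not supply. *)
Definition guess_below (b eta a : V) : Prop :=
  guess b a = coded a eta \/ exists Y, [/\ Y ∈ N a, rel_on 2 a Y &
    triple a rho0 (memV^~ (guess b a)) (memV^~ (coded a eta)) (fiber Y 0)].

Definition marked (b eta a : V) : Prop :=
  [/\ a ∈ S, b ∈ a, card_eq (N a) a, transitive_in a & guess_below b eta a].

Lemma marked_mono b eta xi : Q eta xi -> clubly k (fun a => marked b eta a -> marked b xi a).
Proof.
move=> /hFQ[He Hx [zeta Hz HF]].
have Sk : S ⊆ k by case: hS.
have cl u : baire k u -> clubly k (fun a =>
    coded a u = inter (coded k u) a /\ (a ∈ S -> inter (coded k u) a ∈ N a)).
  move=> Hu; apply: clublyI => //; first exact: clubly_coded_restr.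
  by apply: clubly_guess => // e /mem_coded[].
have := clublyI hk (clubly_nat hk) (clublyI hk
  (clubly_triple_coded hk hS hF hname (fun _ _ => False) (fun _ _ => False) HF)
  (clublyI hk (cl _ He) (clublyI hk (cl _ Hx) (cl _ Hz)))).
move=> /clublyW; apply=> a ak _ [ta [T [[Ee ne] [[Ex nx] [Ez nz]]]]].
move=> [aS ba ca tra gb]; split=> //.
have prN := sees_pr hN aS; have trN := sees_trans hN aS; have aN := sees_self hN aS.
have {Ee ne}eN : coded a eta ∈ N a by rewrite Ee; apply: ne.
have {Ex nx}xN : coded a xi ∈ N a by rewrite Ex; apply: nx.
have {Ez nz}zN : coded a zeta ∈ N a by rewrite Ez; apply: nz.
have [enN _] := hen aS ca.
have gN : guess b a ∈ N a.
  exact: (pr_closed_section prN aN (sees_mem hN aS ba) (enN _ ba)).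
right; case: gb => [E|[Y [YN Ya TY]]].
  exists (slices a [:: coded a zeta]); split; [ | exact: relV_on | ].
    apply: pr_closed_slices => // -[|t] //=; rewrite nth_nil; exact: (pr_closed0 prN).
  rewrite E; apply: triple_ext T => // e ea; exact: (iff_sym (mem_slices [:: _] (ta 0) ea)).
(* The three functions guess, [eta], [xi], then the witness for the first two and the witness [zeta]
   for the last two, in the order of the fibres in [trans_at]. *)
pose Xs := [:: guess b a; coded a eta; coded a xi; section a (nat_V 0) Y; coded a zeta].
have XN : slices a Xs ∈ N a.
  apply: pr_closed_slices => // -[|[|[|[|[|t]]]]] //=; last by rewrite nth_nil; apply: (pr_closed0 prN).
  by apply: pr_closed_section => //; apply: (pr_closed0 prN).
have [Y' [YN' Ya' TY']] := tra _ XN (@relV_on _ _).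
exists Y'; split=> //.
have sl t e : e ∈ a -> fiber (slices a Xs) t e <-> e ∈ nth ∅ Xs t by move=> ea; apply: mem_slices.
apply: (triple_ext _ _ _ _ (TY' _ _)) => // [e ea|e ea||].
- exact: (sl 0).
- exact: (sl 2).
- apply: (triple_ext _ _ _ _ TY) => // e ea; [exact: (iff_sym (sl 0 e ea))|exact: (iff_sym (sl 1 e ea))|].
  apply: (iff_sym (iff_trans (sl 3 e ea) _)); rewrite mem_sep; by split=> [[]|].
- by apply: (triple_ext _ _ _ _ T) => // e ea; [exact: (iff_sym (sl 1 e ea))
    | exact: (iff_sym (sl 2 e ea)) | exact: (iff_sym (sl 4 e ea))].
Qed.

Definition mark (b eta : V) : V := graph k (fun a => if `[< marked b eta a >] then nat_V 1 else ∅).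

Lemma mark_cantor b eta : cantor k (mark b eta).
Proof.
apply: graph_fun => a _; apply/mem_nat2; case: asboolP; by auto.
Qed.

Lemma mark_baire b eta : baire k (mark b eta).
Proof.
apply: graph_fun => a _; case: asboolP => _; first exact: (nat_V_regular hk 1).
exact: (nat_V_regular hk 0).
Qed.

Lemma mark_lt b eta xi a : a ∈ k ->
  app (mark b xi) a ∈ app (mark b eta) a <-> marked b eta a /\ ~ marked b xi a.
Proof.
move=> ak; rewrite !app_graph //; case: asboolP => Mx; case: asboolP => Me.
- by split=> [/memV_irrefl|[]].
- by split=> [/mem_empty|[]].
- by split=> // _; apply/mem_nat1.
- by split=> [/memV_irrefl|[]].
Qed.

Lemma mark_sub_mod b eta xi : Q eta xi -> sub_mod k S (mark b eta) (mark b xi).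
Proof.
move=> HQ; split; [exact: mark_cantor | exact: mark_cantor |].
split; [exact: mark_baire | exact: mark_baire |] => st.
have [a /mem_sep[aS]] := stationary_clubly hk st (marked_mono b HQ).
have ak : a ∈ k by case: hS => sub _; apply: sub.
by move=> /(mark_lt _ _ _ ak)[Me nMx] /(_ Me).
Qed.

Lemma mark_reflects : exists2 b, b ∈ k &
  forall eta xi, baire k eta -> baire k xi -> sub_mod k S (mark b eta) (mark b xi) -> Q eta xi.
Proof.
apply: contrapT => nb.
have Sk : S ⊆ k by case: hS.
have bad b : b ∈ k -> exists p : V * V, [/\ baire k p.1, baire k p.2,
    sub_mod k S (mark b p.1) (mark b p.2) & ~ Q p.1 p.2].
  move=> bk; apply: contrapT => H; apply: nb; exists b => // eta xi He Hx sm.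
  by apply: contrapT => nQ; apply: H; exists (eta, xi).
have [|p Hp] := @choice V (V * V) (fun b p => b ∈ k -> [/\ baire k p.1, baire k p.2,
    sub_mod k S (mark b p.1) (mark b p.2) & ~ Q p.1 p.2]).
  move=> b; have [/bad[p Hp]|n] := pselect (b ∈ k); first by exists p.
  by exists (∅, ∅).
pose H0 b e := e ∈ coded k (p b).1.
pose H1 b e := e ∈ coded k (p b).2.
pose A n := relV k (rho H0 H1 n).
have tagP t s : rho H0 H1 (7 + t) s s <-> s = nat_V t by apply: rhoF_tag.
have modk : models k A phi.
  move=> m sm; apply/(models_in_phi _ (nat_V_regular hk) tagP); split.
    apply: (Hset_hereditary hk sm); apply: (hereditary_seq_V hk) => n; exact: (hereditary_relV hk).
  move=> X _ _.
  (* A witness in [X] would decode to a triple of [F] over the chosen pair, which is not in [Q]. *)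
  have unr : unrelated_at k (rho H0 H1) X.
    move=> b bk T; have [eta [xi [zeta [HF E0 E1 _]]]] := triple_decode hk hS hN hguess hF hname T.
    have [He Hx _] := hF.1 _ _ _ HF; have [He' Hx' _ nQ] := Hp b bk.
    have ek u e : e ∈ coded k u -> e ∈ k by move=> /mem_coded[].
    apply: nQ; have -> : (p b).1 = eta.
      by apply: (coded_inj hk He' He) => e ec; exact: (E0 e (ek _ _ ec)).1 ec.
    have -> : (p b).2 = xi.
      by apply: (coded_inj hk Hx' Hx) => e ec; exact: (E1 e (ek _ _ ec)).1 ec.
    exact: F_Q HF.
  (* When a premise of transitivity fails any [Y] will do, and the empty relation is taken. *)
  have [T1|n1] := pselect (triple k (rho H0 H1) (fiber X 0) (fiber X 1) (fiber X 3)); last first.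
    exists (relV k (fun _ _ => False)); split=> //; last exact: relV_on.
    by apply: (Hset_hereditary hk sm); apply: (hereditary_relV hk).
  have [T2|n2] := pselect (triple k (rho H0 H1) (fiber X 1) (fiber X 2) (fiber X 4)); last first.
    exists (relV k (fun _ _ => False)); split=> //; last exact: relV_on.
    by apply: (Hset_hereditary hk sm); apply: (hereditary_relV hk).
  have [eta [xi [zeta1 [HF1 E1 E2 _]]]] := triple_decode hk hS hN hguess hF hname T1.
  have [xi' [theta [zeta2 [HF2 E2' E3 _]]]] := triple_decode hk hS hN hguess hF hname T2.
  have [He Hx _] := hF.1 _ _ _ HF1; have [Hx' Ht _] := hF.1 _ _ _ HF2.
  have Exi : xi = xi'.
    apply: (coded_inj hk Hx Hx') => e ec; have [ek _] := (mem_coded _ _ _).1 ec.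
    by apply/E2' => //; apply/E2.
  rewrite -Exi in HF2.
  have [_ _ trQ] := hQ; have /hFQ[_ _ [zeta _ HF]] : Q eta theta := trQ _ _ _ (F_Q HF1) (F_Q HF2).
  exists (slices k [:: coded k zeta]); split=> //; last 2 first.
  - exact: relV_on.
  - move=> _ _; apply: (triple_ext _ _ _ _ (triple_coded hk hS hF hname H0 H1 HF)) => // e ek.
    + exact: iff_sym (E1 e ek).
    + exact: iff_sym (E3 e ek).
    + exact: (iff_sym (mem_slices [:: _] (nat_V_regular hk 0) ek)).
  - by apply: (Hset_hereditary hk sm); apply: (hereditary_relV hk).
have stT := hreflect (psi := phi) (fun n => @relV_on k (rho H0 H1 n)) modk.
have bare b : b ∈ k -> clubly k (fun a =>
    [/\ coded a (p b).1 = inter (coded k (p b).1) a, coded a (p b).2 = inter (coded k (p b).2) a,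
        coded a (p b).1 <> coded a (p b).2 &
        ~ (a ∈ S /\ app (mark b (p b).2) a ∈ app (mark b (p b).1) a)]).
  move=> bk; have [He Hx [_ _ [_ _ nst]] nQ] := Hp b bk.
  (* The two functions differ somewhere because [Q] is reflexive; above [x] and the code at [x],
     their codes cut down to [a] differ as well. *)
  have [x xk nx] : exists2 x, x ∈ k & app (p b).1 x <> app (p b).2 x.
    apply: contrapT => H; apply: nQ; suff <- : (p b).1 = (p b).2.
      by have [_ rQ _] := hQ; apply: rQ.
    apply: (is_fun_ext He Hx) => x xk; apply: contrapT => nE; apply: H; by exists x.
  have ex := (is_fun_app He xk).2.
  have cxk : codeV x (app (p b).1 x) ∈ k by apply: codeV_regular.
  have := clublyI hk (clublyI hk (clubly_coded_restr hk He) (clubly_coded_restr hk Hx))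
    (clublyI hk (clublyI hk (clubly_above hk xk) (clubly_above hk cxk))
      (nonstationary_clubly hk _ nst)).
  move=> /(_ _)/clublyW; apply; first by move=> a /mem_sep[/Sk].
  move=> a ak _ [[Ee Ex] [[xa ca] na]]; split=> //.
  - move=> E; have : codeV x (app (p b).1 x) ∈ coded a (p b).2.
      by rewrite -E; apply/mem_coded; split=> //; exists x.
    by rewrite Ex => /mem_inter[/(coded_fun hk Hx xk ex) ].
  - by move=> [aS lt]; apply: na; apply/mem_sep.
have [a /mem_sep[aS [cNa Ma]] [ta Ha]] := stationary_clubly hk stT
  (clublyI hk (clubly_nat hk) (clubly_diag hk bare)).
have ak := Sk _ aS; have asub : a ⊆ k by move=> x xa; apply: regular_trans ak.
(* Restricting the predicates to [a] gives the same [rho] read on [a]. *)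
have EA : (fun n => sep (A n) (is_tuple (arA phi n) a)) = (fun n => relV a (rho H0 H1 n)).
  by apply/funext => n; apply: relV_restr.
rewrite EA in Ma.
have [seqN HM] := (models_in_phi _ ta tagP).1 Ma.
have trN := sees_trans hN aS.
(* The family is the entry of index 5 in the sequence of predicates; transitivity of [N a] descends
   to it through the ordered pair. *)
have relN : relV a (H0 : V -> V -> Prop) ∈ N a.
  pose s := seq_V (fun n => relV a (rho H0 H1 n)).
  have o5 : opair (nat_V 5) (relV a H0) ∈ s by apply/mem_mkV; exists 5.
  have oN := trN _ seqN _ o5.
  have uN : upair (nat_V 5) (relV a H0) ∈ N a by apply: trN oN _ _; apply/mem_upair; right.
  by apply: trN uN _ _; apply/mem_upair; right.
have [_ ensurj] := hen aS cNa; have [b ba Eb] := ensurj _ relN.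
have bk := regular_trans hk ba ak.
have [Ee Ex ne nlt] := Ha b ba.
have gE : guess b a = coded a (p b).1.
  rewrite /guess Eb; apply: V_ext => e; rewrite mem_sep Ee mem_inter mem_relV.
  by split=> [[ea [_ _ ?]]|[? ?]].
apply: nlt; split=> //; apply/mark_lt => //; split.
  split=> //; last by left.
  by move=> X XN Xa; have [Y [YN Ya T _]] := HM X XN Xa; exists Y.
(* If the second function were marked, equality with the guess would contradict [ne]; otherwise the
   witness [Y], put in place of [X] in the reflected sentence, contradicts unrelatedness at [b]. *)
move=> [_ _ _ _ [E|[Y [YN Ya T]]]]; first by apply: ne; rewrite -gE.
have [_ [_ _ _ U]] := HM Y YN Ya.
apply: (U b ba).
(* The two interpretations agree by computation on the symbols 0 to 4, the only ones in [triple]. *)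
have {}T : triple a (rho H0 H1) (memV^~ (guess b a)) (memV^~ (coded a (p b).2)) (fiber Y 0) := T.
apply: (triple_ext _ _ _ _ T) => // e ea.
  by rewrite gE Ee mem_inter; split=> [[]|].
by rewrite Ex mem_inter; split=> [[]|].
Qed.

(** The mark at [a] depends on [eta] only through [coded a eta], hence through its values below [a];
    marks differing at [a] exclude agreement below [a]. *)
Lemma Delta_mark b eta xi : baire k eta -> baire k xi ->
  Delta k eta xi ⊆ Delta k (mark b eta) (mark b xi).
Proof.
move=> He Hx.
have ok := regular_ordinal hk.
pose D u v := adjoin (sep k (fun a => app u a <> app v a)) k.
have least u v : Delta k u v ∈ D u v /\ forall a, a ∈ D u v -> Delta k u v ⊆ a.
  apply: (theP (P := fun m => m ∈ D u v /\ forall a, a ∈ D u v -> m ⊆ a)).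
  have [||m mD Hm] := @ordinal_least (memV^~ (D u v)).
  - by move=> x /mem_adjoin[/mem_sep[xk _]|-> //]; apply: mem_regular_ordinal xk.
  - by exists k; apply/mem_adjoin; right.
  - by exists m.
have [D1 min1] := least eta xi; have [D2 _] := least (mark b eta) (mark b xi).
case/mem_adjoin: D2 => [/mem_sep[ak diff]|->]; last by apply: min1; apply/mem_adjoin; right.
set a := Delta k (mark b eta) (mark b xi) in ak diff *.
have oa := mem_regular_ordinal hk ak.
have oD : ordinal (Delta k eta xi).
  by case/mem_adjoin: D1 => [/mem_sep[xk _]|-> //]; apply: mem_regular_ordinal xk.
apply: ordinal_memPn => // aD; apply: diff.
have agree x : x ∈ a -> app eta x = app xi x.
  move=> xa; apply: contrapT => nE.
  have xk := regular_trans hk xa ak.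
  have Dx : Delta k eta xi ⊆ x by apply: min1; apply/mem_adjoin; left; apply/mem_sep.
  by apply: (@memV_irrefl x); apply: Dx; apply: ordinal_trans xa aD.
have Ec : coded a eta = coded a xi.
  by apply: V_ext => e; rewrite !mem_coded; split=> -[ea [x xa E]]; split=> //; exists x => //;
    rewrite ?agree // -agree.
by rewrite !app_graph // /marked /guess_below Ec.
Qed.

End Marking.

Theorem theoremC (kappa S : V) (hkappa : regular_uncountable kappa)
    (hS : stationary kappa S) (hDl : Dl_star kappa S)
    (Q : V -> V -> Prop) (hQ : quasi_order (baire kappa) Q)
    (hanalytic : analytic kappa Q) :
  reduces1 kappa (baire kappa) Q (cantor kappa) (sub_mod kappa S).
Proof.
have [N [hN hguess hreflect]] := hDl; have [F hF hFQ] := hanalytic.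
have [|name hname] := @choice V (V -> V) (fun a f => a ∈ S ->
    (forall u, u ∈ N a -> f u ∈ kappa) /\ inj_on (N a) f).
  move=> a; have [aS|n] := pselect (a ∈ S); last by exists id.
  by have [[[f Hf] _] _] := hN a aS; exists f.
(* [en a] inverts a bijection of [N a] onto [a], when there is one. *)
have [|en hen] := @choice V (V -> V) (fun a f => a ∈ S -> card_eq (N a) a ->
    (forall b, b ∈ a -> f b ∈ N a) /\ forall u, u ∈ N a -> exists2 b, b ∈ a & f b = u).
  move=> a; have [ca|n] := pselect (card_eq (N a) a); last by exists id.
  have [f [fa fi fs]] := ca.
  have [|g Hg] := @V_choice (memV^~ a) (fun b u => u ∈ N a /\ f u = b).
    by move=> b /fs[u uN E]; exists u.
  exists g => _ _; split=> [b /Hg[]//|u uN]; exists (f u); first exact: fa.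
  by have [gN E] := Hg _ (fa u uN); apply: fi.
have [b bk Hb] := mark_reflects hkappa hS hN hguess hreflect hF hname hQ hFQ hen.
exists (mark kappa S N F name en b) => [eta _|eta xi He Hx]; first exact: mark_cantor.
split; last exact: Delta_mark.
split; first by move=> HQ; apply: mark_sub_mod.
exact: Hb.
Qed.
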